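(* For any real numbers $c, \alpha>0$, there exists $n_0\in \mathbb{N}$ such that the following holds for every integer $n\ge n_0$. \begin{enumerate} \item Every $\lceil c n\rceil$-regular graph of order $n$ contains a collection of at most $\lfloor 1/c \rfloor$ vertex-disjoint paths whose union covers all but at most $\alpha n$ vertices. \item Every bipartite $\lceil c n\rceil$-regular graph of order $n$ contains a collection of at most $\lfloor 1/(2c) \rfloor$ vertex-disjoint paths whose union covers all but at most $\alpha n$ vertices. \end{enumerate}
   Context: Graphs are finite and simple. Paths of length $0$ (single vertices) are allowed as paths. *)

(* Defs.v *)
From HB Require Import structures.
From mathcomp Require Import all_boot all_order all_algebra.
From mathcomp Require Import reals.

Set Implicit Arguments.
Unset Strict Implicit.
Unset Printing Implicit Defensive.

Record sgraph := SGraph {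
  vertex :> finType;
  adj : rel vertex;
  adj_sym : symmetric adj;
  adj_irr : irreflexive adj }.

Definition degree (G : sgraph) (u : G) : nat := #|[set v : G | adj u v]|.

Definition regular (G : sgraph) (d : int) : Prop :=
  forall u : G, Posz (degree u) = d.

Definition bipartite (G : sgraph) : Prop :=
  exists A : {set G}, forall u v : G, adj u v -> (u \in A) != (v \in A).

(* A path is given by its nonempty list of distinct vertices; a single vertex *)
(* is a path.                                                                 *)
Definition is_path (G : sgraph) (p : seq G) : bool :=
  [&& p != [::], sorted (@adj G) p & uniq p].

Definition disjoint_paths (G : sgraph) (P : seq (seq G)) : bool :=
  all (@is_path G) P && pairwise (fun p q : seq G => [disjoint p & q]) P.

Definition uncovered (G : sgraph) (P : seq (seq G)) : {set G} :=
  [set v : G | ~~ has (fun p : seq G => v \in p) P].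

(* Main.v *)
Require Import Defs.
From HB Require Import structures.
From mathcomp Require Import all_boot all_order all_algebra.
From mathcomp Require Import reals.
From mathcomp Require Import boolp zify ring lra.

Set Implicit Arguments.
Unset Strict Implicit.
Unset Printing Implicit Defensive.

(** Call two vertices close if they have linearly many common neighbours.  More
    than [1/c] vertices cannot be pairwise far apart, so deleting a small set [D]
    splits the graph into at most [1/c] classes with few common neighbours across
    classes; take such a splitting with as many classes as possible, the
    tolerances decreasing rapidly as the number of classes drops.  By maximality,
    any two vertices of a class are joined by linearly many disjoint paths of
    bounded length, and this survives inside a small random reserve [U].  Outside
    [U] and [D], almost every vertex sees a single class, so after deleting few
    edges every second vertex of a path stays in one class.  The remaining graph
    is almost regular: colouring it equitably with [t] colours and matching
    consecutive colour classes by Hall's theorem covers it by about [n/t] paths.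
    Those with ends in the same class are joined through [U], which leaves one
    path per class.  In a bipartite graph only the vertices of one side are
    classified; their neighbourhoods lie in a set of size [n/2], whence at most
    [1/(2c)] classes. *)

(** * Matchings, path forests and equitable colourings *)

(** Adjacency need not preserve classes: the two sides of a complete bipartite graph are far apart.
    A class controls distance two, so labels are compared at alternate vertices of a path only, and
    each path is trimmed to begin and end in [A]. The bound [1/c] rests on [x * x - x >= 2 * x - 2]
    for natural [x], the number of chosen vertices adjacent to a given one. The same count bounds
    the length of links, since alternate vertices of a chordless path of close vertices are pairwise
    far. The tolerance for [k] classes is chosen after that for [k + 1]: it must be small against
    the constants (link length, reserve density, number of paths) obtained when no further splitting
    exists at the larger tolerance. The reserve is random because one small set must serve all pairs
    at once and take a similar share of most neighbourhoods, so that the rest stays nearly regular.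
    Probability is replaced by multiaffine functions, rounded coordinate by coordinate. Degrees are
    controlled only through their total deviation, at most [eps * n ^ 2], so some vertices may
    behave arbitrarily. *)

(* Rado's argument: if some [F x] has two elements, one of them can be deleted,
   since sets violating the condition after either deletion would contradict the
   submodularity of the size of the union. *)
Lemma hall_deficiency (T U : finType) (X : {set T}) (F : T -> {set U}) (k : nat) :
  (forall S : {set T}, S \subset X -> #|S| <= #|\bigcup_(x in S) F x| + k) ->
  exists m : T -> U -> bool,
    [/\ forall x y, m x y -> x \in X /\ y \in F x,
        forall x x' y, m x y -> m x' y -> x = x',
        forall x y y', m x y -> m x y' -> y = y' &
        #|X| <= #|[set y | [exists x, m x y]]| + k].
Proof.
have [N] := ubnP (\sum_(x in X) #|F x|).
elim: N F => // N IH F ltN HF.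
have [/existsP[x /andP[xX /card_gt1P[a1 [a2 [a1F a2F a12]]]]]|noX] :=
  boolP [exists x, (x \in X) && (1 < #|F x|)].
  pose Fd a z := if z == x then F x :\ a else F z.
  have Fdsub a z : Fd a z \subset F z.
    by rewrite /Fd; case: eqP => [->|//]; exact: subsetDl.
  have reduce a : a \in F x ->
      (forall S : {set T}, S \subset X -> #|S| <= #|\bigcup_(x in S) Fd a x| + k) ->
      exists m : T -> U -> bool,
    [/\ forall x y, m x y -> x \in X /\ y \in F x,
        forall x x' y, m x y -> m x' y -> x = x',
        forall x y y', m x y -> m x y' -> y = y' &
        #|X| <= #|[set y | [exists x, m x y]]| + k].
    move=> aF H; have [|m [m1 m2 m3 m4]] := IH (Fd a) _ H.
      rewrite ltnS in ltN; apply: leq_trans ltN; rewrite !(bigD1 x xX) /= -addSn leq_add //.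
        by rewrite /Fd eqxx [in X in _ <= X](cardsD1 a) aF add1n.
      by apply: leq_sum => z _; exact: subset_leq_card.
    exists m; split=> // z y /m1[zX yF]; split=> //.
    exact: (subsetP (Fdsub a z)).
  have violate a : ~~ [forall S : {set T}, (S \subset X) ==>
      (#|S| <= #|\bigcup_(x in S) Fd a x| + k)] ->
      exists S : {set T}, S \subset X /\ #|\bigcup_(x in S) Fd a x| + k < #|S|.
    by case/forallPn=> S; rewrite negb_imply -ltnNge => /andP[]; exists S.
  have [/forallP H1|/violate[S1 [S1X V1]]] := boolP [forall S : {set T}, (S \subset X) ==>
      (#|S| <= #|\bigcup_(x in S) Fd a1 x| + k)].
    by apply: (reduce a1) => // S; apply/implyP.
  have [/forallP H2|/violate[S2 [S2X V2]]] := boolP [forall S : {set T}, (S \subset X) ==>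
      (#|S| <= #|\bigcup_(x in S) Fd a2 x| + k)].
    by apply: (reduce a2) => // S; apply/implyP.
  exfalso.
  set P := \bigcup_(x in S1) _ in V1; set Q := \bigcup_(x in S2) _ in V2.
  have nbr a (S : {set T}) z : z \in S -> z != x -> F z \subset \bigcup_(x in S) Fd a x.
    move=> zS zx; apply: subset_trans (bigcup_sup z zS).
    by rewrite /Fd (negbTE zx).
  have xS a (S : {set T}) : S \subset X -> #|\bigcup_(x in S) Fd a x| + k < #|S| -> x \in S.
    move=> SX; rewrite ltnNge; apply: contraNT => xS.
    apply: leq_trans (HF S SX) _; rewrite leq_add2r subset_leq_card //.
    apply/bigcupsP => z zS; apply: nbr => //.
    by apply: contraNneq xS => <-.
  have xS1 := xS _ _ S1X V1; have xS2 := xS _ _ S2X V2.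
  (* Since [a1 != a2], the union [P :|: Q] recovers all of [F x]. In the intersection [x] is
     dropped, which costs one, while the two strict violations gain two. *)
  have HU : #|S1 :|: S2| <= #|P :|: Q| + k.
    apply: leq_trans (HF _ _) _; first by rewrite subUset S1X.
    rewrite leq_add2r subset_leq_card //; apply/bigcupsP => z.
    have [-> _|zx] := eqVneq z x.
      apply/subsetP => y yF; rewrite inE.
      have [ya|ya] := eqVneq y a1.
        apply/orP; right; apply/bigcupP; exists x => //.
        by rewrite /Fd eqxx !inE yF andbT ya.
      by apply/orP; left; apply/bigcupP; exists x => //; rewrite /Fd eqxx !inE yF ya.
    rewrite inE => /orP[] zS.
      exact: subset_trans (nbr a1 _ _ zS zx) (subsetUl _ _).
    exact: subset_trans (nbr a2 _ _ zS zx) (subsetUr _ _).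
  have HI : #|(S1 :&: S2) :\ x| <= #|P :&: Q| + k.
    apply: leq_trans (HF _ _) _.
      by apply: subset_trans (subsetDl _ _) (subset_trans (subsetIl _ _) S1X).
    rewrite leq_add2r subset_leq_card //; apply/bigcupsP => z.
    rewrite !inE => /and3P[zx z1 z2].
    by rewrite subsetI !nbr.
  have := cardsUI P Q; have := cardsUI S1 S2.
  have := cardsD1 x (S1 :&: S2); rewrite inE xS1 xS2 /=.
  lia.
have F1 x : x \in X -> #|F x| <= 1.
  move=> xX; rewrite leqNgt; apply: contra noX => F1.
  by apply/existsP; exists x; rewrite xX.
pose m x y := (y \in F x) && ([pick z in X | y \in F z] == Some x).
have mX x y : m x y -> x \in X.
  rewrite /m => /andP[_ /eqP]; case: pickP => // z /andP[zX _] [<-//].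
exists m; split.
- by move=> x y mxy; rewrite (mX _ _ mxy); case/andP: mxy.
- by move=> x x' y /andP[_ /eqP E] /andP[_ /eqP]; rewrite E => -[].
- move=> x y y' mxy mxy'; have := F1 _ (mX _ _ mxy).
  case/andP: mxy => yF _; case/andP: mxy' => y'F _.
  by move/card_le1_eqP => H; apply: H.
apply: leq_trans (HF X (subxx _)) _; rewrite leq_add2r.
apply: subset_leq_card; apply/subsetP => y /bigcupP[x xX yF].
rewrite inE; apply/existsP.
rewrite /m; case: pickP => [z /andP[zX yz]|/(_ x)]; last by rewrite xX yF.
by exists z; rewrite yz eqxx.
Qed.

(** A partial injection that raises a rank has no cycles, so inside [X] it decomposes into paths,
    one for each vertex without a predecessor. *)
Lemma path_forest (T : finType) (m : rel T) (rk : T -> nat) (X : {set T}) :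
  (forall w v, m w v -> rk w < rk v) ->
  (forall w w' v, m w v -> m w' v -> w = w') ->
  (forall w v v', m w v -> m w v' -> v = v') ->
  exists F : seq (seq T),
    [/\ uniq (flatten F), flatten F =i X,
        all (fun p => (p != [::]) && sorted m p) F &
        size F + #|[set v in X | [exists w in X, m w v]]| = #|X|].
Proof.
move=> mrk m_inj m_fun.
suff: exists F : seq (seq T),
    [/\ uniq (flatten F), flatten F =i X,
        all (fun p => (p != [::]) && sorted m p) F,
        size F + #|[set v in X | [exists w in X, m w v]]| = #|X| &
        forall w, w \in X -> (forall v, v \in X -> ~~ m w v) ->
          exists F1 F2 p, F = F1 ++ rcons p w :: F2].
  by case=> F [? ? ? ? _]; exists F.
have [N] := ubnP #|X|; elim: N X => // N IH X ltN.
have [->|[v0 v0X]] := set_0Vmem X.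
  exists [::]; split=> //; first by move=> x; rewrite !inE.
  - by rewrite cards0 (eq_card0 (A := [set _ in _ | _])) // => x; rewrite !inE.
  - by move=> w; rewrite inE.
pose v := [arg max_(v > v0 in X) rk v].
have [vX vmax] : v \in X /\ forall u, u \in X -> rk u <= rk v.
  by rewrite /v; case: arg_maxnP.
have vout u : u \in X -> ~~ m v u.
  by move=> /vmax; rewrite leqNgt; apply: contra => /mrk.
have [|F [F1 F2 F3 F4 F5]] := IH (X :\ v).
  by rewrite (cardsD1 v) vX add1n ltnS in ltN.
have vF : v \notin flatten F by rewrite F2 !inE eqxx.
set Y := [set _ in X :\ v | _] in F4.
have [/existsP[w /andP[wX mwv]]|nopred] := boolP [exists w in X, m w v].
  have wv : w != v by apply: contraTneq mwv => ->; exact: vout.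
  have [||G1 [G2 [p EF]]] := F5 w; first by rewrite !inE wv.
    move=> u; rewrite !inE => /andP[uv uX]; apply: contra uv => mwu.
    by apply/eqP; apply: m_fun mwu mwv.
  exists (G1 ++ rcons (rcons p w) v :: G2).
  have Efl : perm_eq (flatten (G1 ++ rcons (rcons p w) v :: G2)) (v :: flatten F).
    rewrite EF !flatten_cat /= -(cats1 _ v) -!catA /= perm_sym.
    by rewrite -[v :: _]cat1s perm_catC -!catA perm_cat2l perm_cat2l perm_catC.
  split.
  - by rewrite (perm_uniq Efl) /= vF.
  - move=> x; rewrite (perm_mem Efl) inE F2 !inE.
    by case: eqP => [->|].
  - move: F3; rewrite EF !all_cat /= => /and3P[-> /andP[_ s] ->].
    rewrite andbT; apply/andP; split; first by case: (rcons p w).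
    case: p s {EF Efl} => [|a p] /=; first by rewrite mwv.
    by rewrite !rcons_path last_rcons mwv => ->.
  - have -> : [set v1 in X | [exists w0 in X, m w0 v1]] = v |: Y.
      apply/setP => u; rewrite !inE; have [->|uv] /= := eqVneq u v.
        by rewrite vX; apply/existsP; exists w; rewrite wX.
      have [uX|//] := boolP (u \in X); apply: eq_existsb => z; rewrite !inE.
      by have [->|//] := eqVneq z v; rewrite vX /= (negbTE (vout _ uX)).
    rewrite cardsU1 !inE eqxx /= [RHS](cardsD1 v) vX -F4 EF !size_cat /=; lia.
  - move=> u uX uout; have [->|uv] := eqVneq u v.
      by exists G1, G2, (rcons p w).
    have [||H1 [H2 [r EF']]] := F5 u; first by rewrite !inE uv.
      by move=> z; rewrite !inE => /andP[_ /uout].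
    have : rcons r u \in F by rewrite EF' mem_cat inE eqxx orbT.
    rewrite EF mem_cat inE => /or3P[|/eqP/rcons_inj[_ uw]|].
    + by case/splitPr=> s1 s2; exists s1, (s2 ++ rcons (rcons p w) v :: G2), r; rewrite -catA.
    + by have := uout v vX; rewrite uw mwv.
    + case/splitPr=> s1 s2; exists (G1 ++ rcons (rcons p w) v :: s1), s2, r.
      by rewrite -catA.
exists ([:: v] :: F); split.
- by rewrite /= vF.
- move=> x; rewrite /= inE F2 !inE.
  by case: eqP => [->|].
- by [].
- have -> : [set v1 in X | [exists w0 in X, m w0 v1]] = Y.
    apply/setP => u; rewrite !inE; have [->|uv] /= := eqVneq u v.
      by rewrite vX; apply/negbTE.
    have [uX|//] := boolP (u \in X); apply: eq_existsb => z; rewrite !inE.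
    by have [->|//] := eqVneq z v; rewrite vX /= (negbTE (vout _ uX)).
  by rewrite [RHS](cardsD1 v) vX -F4.
- move=> u uX uout; have [->|uv] := eqVneq u v; first by exists [::], F, [::].
  have [||H1 [H2 [r EF']]] := F5 u; first by rewrite !inE uv.
    by move=> z; rewrite !inE => /andP[_ /uout].
  by exists ([:: v] :: H1), H2, r; rewrite EF'.
Qed.

Section EquitableColouring.
Variables (T : finType) (e : rel T) (t : nat).
Hypothesis e_sym : symmetric e.

Definition cdeg (f : T -> 'I_t) (i : 'I_t) (v : T) : nat :=
  \sum_(u | e v u) (f u == i).

Lemma sum_cdeg f v : \sum_(i < t) cdeg f i v = \sum_(u | e v u) 1.
Proof.
rewrite exchange_big /=; apply: eq_bigr => u _.
by rewrite (bigD1 (f u)) //= eqxx big1 // => i /negbTE; rewrite eq_sym => ->.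
Qed.

(* A colouring minimising the left-hand side: recolouring one vertex [x] does
   not decrease it, and these inequalities are summed over [x] and the new colour. *)
Lemma equitable_colouring : 0 < t ->
  exists f : T -> 'I_t,
    t * \sum_v \sum_(i < t) cdeg f i v ^ 2 <=
    \sum_v (\sum_(u | e v u) 1) * ((\sum_(u | e v u) 1) + t).
Proof.
move=> t_gt0.
pose Phi (f : {ffun T -> 'I_t}) := \sum_v \sum_(i < t) cdeg f i v ^ 2.
pose f := [arg min_(f < [ffun=> Ordinal t_gt0]) Phi f].
have fmin g : Phi f <= Phi g.
  by rewrite /f; case: arg_minnP => // h _; exact.
exists f.
(* For [j] other than [f x], recolouring [x] with [j] changes [Phi] by twice the right side minus
   the left side. *)
have step x (j : 'I_t) :
    \sum_(v | e x v) cdeg f (f x) v <= \sum_(v | e x v) (cdeg f j v + 1).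
  have [->|jx] := eqVneq j (f x).
    by apply: leq_sum => v _; rewrite leq_addr.
  pose g : {ffun T -> 'I_t} := [ffun u => if u == x then j else f u].
  have gx : g x = j by rewrite ffunE eqxx.
  have gu u : u != x -> g u = f u by rewrite ffunE => /negbTE->.
  have dg v i : cdeg g i v + (e v x && (f x == i)) = cdeg f i v + (e v x && (j == i)).
    rewrite /cdeg; have [evx|nevx] := boolP (e v x); last first.
      rewrite !addn0; apply: eq_bigr => u evu; rewrite gu //.
      by apply: contraTneq evu => ->.
    rewrite /= !(bigD1 x evx) /= gx.
    rewrite (eq_bigr (fun u => (f u == i) : nat)); first by rewrite addnC addnA addnAC.
    by move=> u /andP[_ ux]; rewrite gu.
  have dg2 v : \sum_(i < t) cdeg g i v ^ 2 + 2 * (e v x * cdeg f (f x) v) =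
      \sum_(i < t) cdeg f i v ^ 2 + 2 * (e v x * (cdeg f j v + 1)).
    have xj : f x != j by rewrite eq_sym.
    rewrite (bigD1 j) //= (bigD1 (f x)) //= [in RHS](bigD1 j) //= [in RHS](bigD1 (f x)) //=.
    rewrite (eq_bigr (fun i => cdeg f i v ^ 2)); last first.
      move=> i /andP[ij ifx]; have := dg v i.
      by rewrite ![_ == i]eq_sym (negbTE ij) (negbTE ifx) !andbF !addn0 => ->.
    set s := \sum_(i < t | _) _.
    have := dg v j; have := dg v (f x).
    rewrite !eqxx (negbTE jx) (negbTE xj) !andbT !andbF !addn0.
    case: (e v x) => /=; last by rewrite !addn0 => -> ->.
    move=> <- ->; rewrite !mul1n !expnS !expn0; nia.
  have H : \sum_v (\sum_(i < t) cdeg g i v ^ 2 + 2 * (e v x * cdeg f (f x) v)) =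
      \sum_v (\sum_(i < t) cdeg f i v ^ 2 + 2 * (e v x * (cdeg f j v + 1))).
    by apply: eq_bigr => v _; exact: dg2.
  have E (F : T -> nat) : \sum_v 2 * (e v x * F v) = 2 * \sum_(v | e x v) F v.
    rewrite big_distrr [RHS]big_mkcond; apply: eq_bigr => v _.
    by rewrite e_sym; case: (e x v); rewrite ?mul1n.
  rewrite big_split [RHS]big_split /= !E in H.
  rewrite -(leq_pmul2l (isT : 0 < 2)) -(leq_add2l (Phi f)) -H leq_add2r.
  exact: fmin.
(* Both sides become sums over ordered adjacent pairs, so that [step] can be summed over [x] and
   [j]. *)
have -> : \sum_v \sum_(i < t) cdeg f i v ^ 2 =
    \sum_x \sum_(v | e x v) cdeg f (f x) v.
  rewrite [RHS](exchange_big_dep predT) //=; apply: eq_bigr => v _.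
  under eq_bigr => i _ do rewrite expnS expn1 {1}/cdeg big_distrl /=.
  rewrite exchange_big /=; apply: eq_big => [u|u _]; first by rewrite e_sym.
  rewrite (bigD1 (f u)) //= eqxx mul1n big1 ?addn0 // => i /negbTE.
  by rewrite eq_sym => ->.
have -> : \sum_v (\sum_(u | e v u) 1) * ((\sum_(u | e v u) 1) + t) =
    \sum_x \sum_(v | e x v) \sum_(j < t) (cdeg f j v + 1).
  rewrite [RHS](exchange_big_dep predT) //=; apply: eq_bigr => v _.
  rewrite big_distrl /=; apply: eq_big => [u|u _]; first by rewrite e_sym.
  by rewrite mul1n big_split /= sum_cdeg [X in _ = _ + X]sum_nat_const card_ord muln1.
rewrite big_distrr /=; apply: leq_sum => x _.
rewrite exchange_big /=.
have -> : t * \sum_(v | e x v) cdeg f (f x) v =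
   \sum_(j < t) \sum_(v | e x v) cdeg f (f x) v.
  by rewrite sum_nat_const card_ord.
by apply: leq_sum => j _; exact: step.
Qed.

End EquitableColouring.

(** * Merging and trimming paths *)

Lemma not_uniq_map (S : eqType) (T : eqType) (h : S -> T) (s : seq S) :
  ~~ uniq (map h s) -> exists a b s', perm_eq s [:: a, b & s'] /\ h a = h b.
Proof.
elim: s => //= a s IH; rewrite negb_and negbK => /orP[/mapP[b bs hab]|/IH[b [b' [s' [ps hb]]]]].
  by exists a, b, (rem b s); rewrite perm_cons perm_to_rem.
exists b, b', (a :: s'); split=> //.
rewrite -[a :: s]cat1s -[[:: b, b', a & s']]/([:: b; b'] ++ [:: a] ++ s').
by rewrite perm_sym perm_catCA perm_cat2l perm_sym.
Qed.

Section Merging.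
Variables (G : sgraph) (lab : G -> nat) (good : pred G).
Implicit Types p : seq G.

Definition good_path p : bool :=
  if p is x :: s then
    [&& good x, good (last x s), lab x == lab (last x s) & path (@adj G) x s]
  else false.

Definition path_lab p : nat := if p is x :: _ then lab x else 0.

Lemma merge_paths (U : {set G}) (k L b : nat) (F : seq (seq G)) :
  (forall u v (Q : {set G}), good u -> good v -> u != v -> lab u = lab v -> #|Q| <= b ->
     exists p, [/\ path (@adj G) u (rcons p v), uniq p, size p <= L,
                   {subset p <= U} & forall x, x \in p -> x \notin Q]) ->
  (forall u, good u -> lab u < k) ->
  uniq (flatten F) -> all good_path F ->
  count (mem U) (flatten F) + L * size F <= b ->
  exists P, [/\ uniq (flatten P), all good_path P, size P <= k &
                {subset flatten F <= flatten P}].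
Proof.
move=> link labk; have [N] := ubnP (size F); elim: N F => // N IH F ltN uF gF cF.
have [sk|sk] := leqP (size F) k; first by exists F; split.
have : ~~ uniq (map path_lab F).
  apply: contraL sk => um; rewrite -leqNgt -(size_map path_lab) -(size_iota 0 k).
  apply: uniq_leq_size => // i /mapP[p pF ->]; rewrite mem_iota /=.
  by move/allP: gF => /(_ p pF); case: p {pF} => //= x s /and4P[/labk].
case/not_uniq_map=> p [p' [F' [pF hp]]].
have gF' : all good_path [:: p, p' & F'] by rewrite -(perm_all _ pF).
have pfl : perm_eq (flatten F) (flatten [:: p, p' & F']) by exact: perm_flatten.
have sF : size F = (size F').+2 by rewrite (perm_size pF).
case: p p' pF hp gF' pfl => [|x s] [|y r] //= pF hp; rewrite ?andbF //.
case/and3P=> /and4P[gx gu /eqP lx px] /and4P[gy gv /eqP ly py] gF' pfl.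
set u := last x s in gu lx.
pose Q := [set z in filter (mem U) (flatten F)].
have uF' : uniq (x :: s ++ (y :: r) ++ flatten F') by rewrite -(perm_uniq pfl).
have neq : u != y.
  apply: contraTneq uF' => uy; rewrite -cat_cons cat_uniq.
  suff -> : has (mem (x :: s)) ((y :: r) ++ flatten F') by rewrite andbF.
  by apply/hasP; exists y; rewrite ?mem_head // -uy; exact: mem_last.
have Qb : #|Q| <= b.
  rewrite cardsE (leq_trans (card_size _)) // size_filter (leq_trans _ cF) //.
  exact: leq_addr.
have lab_uy : lab u = lab y by rewrite -lx.
have [w [w1 w2 w3 w4 w5]] := link u y Q gu gy neq lab_uy Qb.
pose p0 := x :: s ++ rcons w y ++ r.
have pfl' : perm_eq (flatten (p0 :: F')) (w ++ flatten F).
  rewrite perm_sym (perm_trans (_ : perm_eq _ (w ++ (x :: s) ++ (y :: r) ++ flatten F'))) //.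
    by rewrite perm_cat2l.
  by rewrite perm_catCA /p0 -cats1 /= -!catA.
have [||||P [P1 P2 P3 P4]] := IH (p0 :: F').
- by move: ltN; rewrite sF.
- rewrite (perm_uniq pfl') cat_uniq w2 uF andbT /=.
  apply/hasPn => z zF; apply/negP => zw; have := w5 z zw.
  by rewrite inE mem_filter /= (w4 z zw) zF.
- rewrite /= gF' andbT last_cat last_cat last_rcons gx gv lx lab_uy ly eqxx /=.
  by rewrite cat_path px /= -/u cat_path w1 last_rcons.
- move: cF; rewrite (permP pfl') count_cat sF /=; apply: leq_trans.
  rewrite [L * _.+2]mulnS [X in _ <= X]addnA leq_add2r addnC leq_add2l.
  exact: leq_trans (count_size _ _) w3.
exists P; split=> // z zF; apply: P4; rewrite (perm_mem pfl') mem_cat zF orbT //.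
Qed.

End Merging.

Section Trimming.
Variables (G : sgraph) (lab : G -> nat) (A B X : {set G}) (e : rel G).
Hypothesis e_sym : symmetric e.
Hypothesis e_adj : forall u v, e u v -> adj u v.
Hypothesis eX : forall u v, e u v -> v \in X.
Hypothesis AB : forall u v : G, adj u v -> u \in A -> v \in B.
Hypothesis BA : forall u v : G, adj u v -> u \in B -> v \in A.
Hypothesis cover : forall u : G, (u \in A) || (u \in B).
Hypothesis e_lab : forall y x z, y \in B -> e y x -> e y z -> lab x = lab z.

Let good : pred G := [pred u | (u \in A) && (u \in X)].

(** The path is read two steps at a time: the vertices before and after a [B]-vertex share their
    label, so all vertices at even positions do. A leftover last vertex at an odd position is
    cut. *)
Lemma trim_end x s : x \in A -> x \in X -> path e x s ->
  exists s', [/\ subseq s' s, size s <= (size s').+1 & good_path lab good (x :: s')].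
Proof.
have [N] := ubnP (size s); elim: N x s => // N IH x [|y [|z r]] ltN xA xX /=.
- by move=> _; exists [::]; split=> //; rewrite /= /good /= xA xX eqxx.
- by move=> _; exists [::]; split=> //; rewrite /= /good /= xA xX eqxx.
case/and3P=> exy eyz pr.
have yB := AB (e_adj exy) xA; have zA := BA (e_adj eyz) yB.
have [|s' [s1 s2 /= s3]] := IH z r _ zA (eX eyz) pr; first by move: ltN => /= ?; lia.
exists [:: y, z & s']; split.
- by rewrite /= !eqxx.
- by rewrite /= !ltnS.
case/and4P: s3 => gz gl /eqP lz pz; rewrite /= {1}/good /= xA xX gl /= -lz (e_adj exy) (e_adj eyz) pz.
by rewrite (e_lab yB (_ : e y x) eyz) ?eqxx // e_sym.
Qed.

(** At most one vertex is lost at each end; a single vertex outside [A] disappears altogether. *)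
Lemma trim_path p : sorted e p -> all (mem X) p ->
  exists p', [/\ subseq p' p, size p <= size p' + 2 &
                (p' == [::]) || good_path lab good p'].
Proof.
case: p => [|x s] /=; first by exists [::].
move=> pth /andP[xX _]; have [xA|xA] := boolP (x \in A).
  have [s' [s1 s2 s3]] := trim_end xA xX pth.
  exists (x :: s'); split; [by rewrite /= eqxx|by rewrite /= addn2 ltnS; exact: leqW|exact: s3].
have xB : x \in B by move: (cover x); rewrite (negbTE xA).
case: s pth => [|y r] /=; first by exists [::].
case/andP=> exy pr; have yA := BA (e_adj exy) xB.
have [s' [s1 s2 s3]] := trim_end yA (eX exy) pr.
have sub : subseq (y :: s') [:: x, y & r].
  by apply: (@subseq_trans _ (y :: r)); [rewrite /= eqxx|exact: subseq_cons].
exists (y :: s'); split; [|by rewrite /= addn2 !ltnS|exact: s3].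
exact: sub.
Qed.

Lemma trim_forest F : all (sorted e) F -> all (mem X) (flatten F) ->
  exists F', [/\ subseq (flatten F') (flatten F), size F' <= size F,
                 size (flatten F) <= size (flatten F') + 2 * size F &
                 all (good_path lab good) F'].
Proof.
elim: F => [|p F IH] /=; first by exists [::].
case/andP=> sp sF; rewrite all_cat => /andP[Xp XF].
have [F' [F1 F2 F3 F4]] := IH sF XF.
have [p' [p1 p2 /orP[/eqP p0|p3]]] := trim_path sp Xp.
  exists F'; split=> //.
  - by apply: subseq_trans F1 _; apply: suffix_subseq.
  - exact: leqW.
  - by move: p2; rewrite p0 size_cat mulnS [X in _ -> _ <= X]addnCA => p2; apply: leq_add.
exists (p' :: F'); split=> //=.
- exact: cat_subseq.
- by rewrite !size_cat mulnS addnACA leq_add.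
- by rewrite p3.
Qed.

End Trimming.

Import Order.TTheory GRing.Theory Num.Theory.
Local Open Scope ring_scope.

(** * Path forests of nearly regular graphs *)

(** Turns bounds on sums of squares into bounds on sums of absolute deviations; [a] will be a small
    multiple of [n]. *)
Lemma norm_le_sqr (R : realFieldType) (a x : R) : 0 < a -> `|x| <= a + x ^+ 2 / a.
Proof.
move=> a0; rewrite -subr_ge0 -(pmulr_rge0 _ a0).
have -> : a * (a + x ^+ 2 / a - `|x|) = a ^+ 2 + `|x| ^+ 2 - a * `|x|.
  by rewrite real_normK ?num_real //; field; rewrite gt_eqF.
by have := normr_ge0 x; move: `|x| => y y0; nra.
Qed.

Lemma ler_sum_subset (R : numDomainType) (T : finType) (S A : {set T}) (F : T -> R) :
  S \subset A -> (forall x, 0 <= F x) -> \sum_(x in S) F x <= \sum_(x in A) F x.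
Proof.
move=> SA F0; rewrite [leRHS](big_setID S) /= (setIidPr SA) lerDl.
by apply: sumr_ge0.
Qed.

(** The edges leaving a subset [S] of [A] number about [D] per vertex, counted from [S] or from its
    neighbourhood. So [S] exceeds its neighbourhood by at most the total deviation over [D], which
    is the deficiency allowed in Hall's condition. *)
Lemma near_regular_matching (R : realType) (T : finType) (e : rel T)
    (A B : {set T}) (D : R) : 0 < D ->
  exists m : rel T,
    [/\ forall x y, m x y -> [/\ x \in A, y \in B & e x y],
        forall x x' y, m x y -> m x' y -> x = x',
        forall x y y', m x y -> m x y' -> y = y' &
        (#|A|%:R - #|[set y | [exists x, m x y]]|%:R) * D <=
          \sum_(x in A) `|(\sum_(y in B) e x y)%:R - D| +
          \sum_(y in B) `|(\sum_(x in A) e x y)%:R - D|].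
Proof.
move=> D0; pose dB x := (\sum_(y in B) e x y)%N; pose dA y := (\sum_(x in A) e x y)%N.
pose E := \sum_(x in A) `|(dB x)%:R - D| + \sum_(y in B) `|(dA y)%:R - D|.
have E0 : 0 <= E by apply: addr_ge0; apply: sumr_ge0.
pose F x := [set y in B | e x y].
have [S SA|m [m1 m2 m3 m4]] := @hall_deficiency T T A F (Num.truncn (E / D)).
  set N := \bigcup_(x in S) F x.
  have NB : N \subset B.
    by apply/bigcupsP => x _; apply/subsetP => y; rewrite inE => /andP[].
  have count : (\sum_(x in S) dB x <= \sum_(y in N) dA y)%N.
    rewrite /dB exchange_big /= (bigID (mem N)) /= [X in (_ + X)%N]big1 ?addn0.
      rewrite [X in (X <= _)%N](eq_bigl (mem N)); last first.
        by move=> y /=; case yN: (y \in N); rewrite ?andbF // (subsetP NB).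
      apply: leq_sum => y yN; rewrite [X in (_ <= X)%N](bigID (mem S)) /=.
      rewrite [X in (_ <= X + _)%N](eq_bigl (mem S)) ?leq_addr // => x /=.
      by case xS: (x \in S); rewrite ?andbF // (subsetP SA).
    move=> y /andP[yB yN]; apply: big1 => x xS.
    case exy: (e x y) => //; case/negP: yN; apply/bigcupP; exists x => //.
    by rewrite inE yB.
  have lower : #|S|%:R * D - \sum_(x in A) `|(dB x)%:R - D| <=
      (\sum_(x in S) dB x)%:R.
    rewrite lerBlDr natr_sum.
    apply: le_trans (lerD (lexx _) (ler_sum_subset SA (fun x => normr_ge0 _))).
    rewrite -big_split /= mulr_natl -sumr_const; apply: ler_sum => x _.
    by have := ler_norm (- ((dB x)%:R - D)); rewrite normrN; lra.
  have upper : (\sum_(y in N) dA y)%:R <=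
      #|N|%:R * D + \sum_(y in B) `|(dA y)%:R - D|.
    apply: le_trans (lerD (lexx _) (ler_sum_subset NB (fun x => normr_ge0 _))).
    rewrite natr_sum mulr_natl -sumr_const -big_split /=; apply: ler_sum => y _.
    by have := ler_norm ((dA y)%:R - D); lra.
  have key : (#|S|%:R - #|N|%:R) * D <= E.
    by have := count; rewrite -(ler_nat R) /E; lra.
  have [SN|NS] := leqP #|S| #|N|; first by apply: leq_trans SN (leq_addr _ _).
  rewrite -leq_subLR truncn_ge_nat ?divr_ge0 ?(ltW D0) //.
  by rewrite ler_pdivlMr // natrB // ltnW.
exists m; split=> //.
  by move=> x y /m1[xA]; rewrite inE => /andP[].
move: m4; set k := Num.truncn _; rewrite -(ler_nat R) natrD => m4.
apply: (@le_trans _ _ (k%:R * D)); first by rewrite ler_wpM2r ?(ltW D0) //; lra.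
by rewrite -ler_pdivlMr // truncn_le divr_ge0 ?(ltW D0).
Qed.

(** Following the matchings from class [i] to class [i + 1], the number of paths is at most the loss
    of the matchings plus the size of the last class. In [2 * t + 1], each class enters at most two
    matchings, whose losses are measured against [d / t]; the last 1 comes from estimating the last
    class. *)
Lemma layered_forest (R : realType) (T : finType) (e : rel T) (X : {set T})
    (t' : nat) (f : T -> 'I_t'.+1) (d : R) :
  symmetric e -> (forall u v, e u v -> v \in X) -> 0 < d ->
  exists F : seq (seq T),
    [/\ uniq (flatten F), flatten F =i X,
        all (fun p => (p != [::]) && sorted e p) F &
        (size F)%:R * d <= #|T|%:R * (d / t'.+1%:R) +
          (2 * t'.+1%:R + 1) *
            (\sum_(v in X) \sum_(j < t'.+1) `|(cdeg e f j v)%:R - d / t'.+1%:R|) +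
          \sum_(v in X) `|(\sum_(u | e v u) 1)%N%:R - d|].
Proof.
move=> e_sym eX d0; set t := t'.+1%:R; set D1 := d / t.
have t0 : 0 < t :> R by rewrite ltr0n.
have D10 : 0 < D1 by rewrite divr_gt0.
have DtE : D1 * t = d by rewrite /D1 mulfVK // gt_eqF.
set Delta := \sum_(v in X) \sum_(j < _) _.
set delta := \sum_(v in X) `|_|.
pose V j := [set v in X | f v == j].
pose w0 (i : 'I_t') := widen_ord (leqnSn t') i.
pose w1 (i : 'I_t') := lift ord0 i.
have /fin_all_exists[M HM] (i : 'I_t') := near_regular_matching e (V (w0 i)) (V (w1 i)) D10.
pose m w v := [exists i, M i w v].
have mP w v : m w v -> exists i, [/\ M i w v, w \in X, v \in X, f w = w0 i & f v = w1 i].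
  case/existsP=> i mi; exists i; have [+ _ _ _] := HM i => /(_ _ _ mi)[].
  by rewrite !inE => /andP[-> /eqP->] /andP[-> /eqP->].
have w0_inj : injective w0 by move=> i j /(congr1 val) /= /val_inj.
have w1_inj : injective w1 by apply: lift_inj.
have [||w v v'|F [F1 F2 F3 F4]] := @path_forest T m (fun v => f v) X.
- by move=> w v /mP[i [_ _ _ -> ->]] /=.
- move=> w w' v /mP[i [mi _ _ _ fv]] /mP[j [mj _ _ _]]; rewrite fv => /w1_inj ij.
  by subst j; have [_ + _ _] := HM i => /(_ _ _ _ mi mj).
- move=> /mP[i [mi _ _ fw _]] /mP[j [mj _ _]]; rewrite fw => /w0_inj ij _.
  by subst j; have [_ _ + _] := HM i => /(_ _ _ _ mi mj).
exists F; split=> //.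
  apply/allP => p /(allP F3)/andP[-> /=]; apply: sub_sorted => u v /mP[i [mi _ _ _ _]].
  by have [+ _ _ _] := HM i => /(_ _ _ mi)[].
set Y := [set v in X | _] in F4.
pose tg i := [set y | [exists x, M i x y]].
have cX : #|X| = (\sum_(i < t') #|V (w0 i)| + #|V ord_max|)%N.
  rewrite -sum1_card (partition_big f predT) //= big_ord_recr /=.
  congr (_ + _)%N; first apply: eq_bigr => i _; rewrite -sum1_card; apply: eq_bigl => v;
    by rewrite inE.
have cY : (\sum_(i < t') #|tg i| <= #|Y|)%N.
  rewrite -(sum1_card (mem Y)) (partition_big f predT) //= big_ord_recl /=.
  apply: leq_trans (leq_addl _ _); apply: leq_sum => i _.
  rewrite sum1dep_card; apply: subset_leq_card; apply/subsetP => y.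
  rewrite !inE => /existsP[x mxy].
  have /mP[j [mj xX yX fx fy]] : m x y by apply/existsP; exists i.
  have [+ _ _ _] := HM i => /(_ _ _ mxy)[_].
  rewrite inE => /andP[_ /eqP ->] _; rewrite yX eqxx andbT /=.
  by apply/existsP; exists x; rewrite xX; apply/existsP; exists i.
have dBE x (j : 'I_t'.+1) : (\sum_(y in V j) e x y)%N = cdeg e f j x.
  rewrite /cdeg big_mkcond [RHS]big_mkcond; apply: eq_bigr => y _.
  by rewrite inE; case exy: (e x y); rewrite ?if_same // (eX _ _ exy); case: eqP.
have dAE y (j : 'I_t'.+1) : (\sum_(x in V j) e x y)%N = cdeg e f j y.
  by rewrite -dBE; apply: eq_bigr => x _; rewrite e_sym.
have VX j : V j \subset X by apply/subsetP => v; rewrite inE => /andP[].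
have match_bound : (\sum_(i < t') #|V (w0 i)|%:R - \sum_(i < t') #|tg i|%:R) * D1 <= 2 * Delta.
  rewrite -sumrB mulr_suml.
  apply: (@le_trans _ _ (\sum_(i < t') (\sum_(v in X) `|(cdeg e f (w1 i) v)%:R - D1| +
                       \sum_(v in X) `|(cdeg e f (w0 i) v)%:R - D1|))).
    apply: ler_sum => i _; have [_ _ _ H] := HM i; apply: le_trans H _.
    apply: lerD.
      under eq_bigr => x _ do rewrite dBE.
      exact: ler_sum_subset.
    under eq_bigr => x _ do rewrite dAE.
    exact: ler_sum_subset.
  rewrite big_split /= mulr_natl mulr2n; apply: lerD.
    rewrite /Delta [leRHS]exchange_big /= big_ord_recl /= lerDr; exact: sumr_ge0.
  rewrite /Delta [leRHS]exchange_big /= big_ord_recr /= lerDl; exact: sumr_ge0.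
(* Edges at the last class are counted twice: about [d] from each of its vertices, and about [d / t]
   from each vertex of [X]. *)
have last_bound : #|V ord_max|%:R * d <= #|T|%:R * D1 + Delta + delta.
  have cnt : (\sum_(u in V ord_max) \sum_(v | e u v) 1 <= \sum_(v in X) cdeg e f ord_max v)%N.
    rewrite (exchange_big_dep (mem X)) /=; last by move=> u v _ /eX.
    apply: leq_sum => v vX; rewrite -dBE [X in (_ <= X)%N]big_mkcond big_mkcondr /= -big_mkcondr /=.
    rewrite big_mkcond /=; apply: leq_sum => u _.
    by rewrite e_sym; case: (u \in V _) => //=; case: (e v u).
  have lo : #|V ord_max|%:R * d - delta <= (\sum_(u in V ord_max) \sum_(v | e u v) 1)%N%:R.
    rewrite lerBlDr natr_sum.
    apply: le_trans (lerD (lexx _) (ler_sum_subset (VX ord_max) (fun x => normr_ge0 _))).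
        rewrite -big_split /= mulr_natl -sumr_const; apply: ler_sum => x _.
    by have := ler_norm (- ((\sum_(v | e x v) 1)%N%:R - d)); rewrite normrN; lra.
  have hi : (\sum_(v in X) cdeg e f ord_max v)%N%:R <= #|T|%:R * D1 + Delta.
    apply: (@le_trans _ _ (#|X|%:R * D1 + Delta)); last first.
      by rewrite lerD2r; apply: ler_wpM2r; rewrite ?(ltW D10) // ler_nat max_card.
    rewrite natr_sum mulr_natl -sumr_const /Delta -big_split /=; apply: ler_sum => v _.
    rewrite (bigD1 ord_max) //= addrA -[leLHS]addr0; apply: lerD; last exact: sumr_ge0.
    by have := ler_norm ((cdeg e f ord_max v)%:R - D1); lra.
  by move: cnt; rewrite -(ler_nat R); lra.
have sF : (size F)%:R <= (\sum_(i < t') #|V (w0 i)|%:R - \sum_(i < t') #|tg i|%:R) + #|V ord_max|%:R :> R.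
  move: cY F4; rewrite cX -(ler_nat R) => cY /(congr1 (GRing.natmul (1 : R))).
  by rewrite !natrD; move: cY; rewrite !natr_sum; lra.
apply: (@le_trans _ _ (((\sum_(i < t') #|V (w0 i)|%:R - \sum_(i < t') #|tg i|%:R) + #|V ord_max|%:R) * d)).
  by rewrite ler_wpM2r // ltW.
rewrite mulrDl -{1}DtE mulrA.
have : (\sum_(i < t') #|V (w0 i)|%:R - \sum_(i < t') #|tg i|%:R) * D1 * t <= 2 * Delta * t.
  by rewrite ler_wpM2r // ltW.
by lra.
Qed.

Lemma near_regular_forest (R : realType) (c eta : R) : 0 < c -> 0 < eta ->
  exists2 eps : R, 0 < eps & exists n0 : nat,
  forall (T : finType) (e : rel T) (X : {set T}) (d : R),
    symmetric e -> (forall u v, e u v -> v \in X) ->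
    (n0 <= #|T|)%N -> c * #|T|%:R <= d ->
    \sum_(v in X) `|(\sum_(u | e v u) 1)%N%:R - d| <= eps * #|T|%:R ^+ 2 ->
  exists F : seq (seq T),
    [/\ uniq (flatten F), flatten F =i X,
        all (fun p => (p != [::]) && sorted e p) F &
        (size F)%:R <= eta * #|T|%:R].
Proof.
move=> c0 eta0.
(* [t] makes the main term [n / t] at most half of [eta * n]. [e1] and [eps] make the quadratic
   errors [(2 * t + 1) * t * e1] and [(2 * t + 2) * eps] equal to [k / 4] each, and [n0] brings the
   linear term below [k / 4 * n ^ 2]. *)
pose t' := Num.truncn (2 / eta); have [t Et] : exists t : R, t = t'.+1%:R by exists t'.+1%:R.
have t0 : 0 < t by rewrite Et ltr0n.
have tinv : t^-1 <= eta / 2.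
  have H : 2 / eta < t by rewrite Et; apply: truncnS_gt.
  rewrite -[leRHS]invrK lef_pV2 ?posrE ?invr_gt0 ?divr_gt0 //.
  by rewrite invf_div ltW.
pose k := eta * c / 2; have k0 : 0 < k by rewrite /k divr_gt0 ?mulr_gt0.
pose e1 := k / (4 * t * (2 * t + 1)).
have e10 : 0 < e1 by rewrite divr_gt0 // ?mulr_gt0 //; lra.
pose eps := k / (4 * (2 * t + 2)).
have eps0 : 0 < eps by rewrite divr_gt0 // mulr_gt0 //; lra.
exists eps => //; pose n0 := (Num.truncn (4 * (2 * t + 1) / (e1 * k))).+1.
exists n0 => T e X d e_sym eX n0T cd dev.
pose n : R := #|T|%:R; rewrite -/n in cd dev *.
have n_gt0 : 0 < n by rewrite ltr0n (leq_trans _ n0T).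
have nbig : 4 * (2 * t + 1) / (e1 * k) <= n.
  apply: (@le_trans _ _ (n0%:R)); last by rewrite ler_nat.
  by rewrite ltW // truncnS_gt.
have d0 : 0 < d by apply: lt_le_trans cd; rewrite mulr_gt0.
have [f Hf] := @equitable_colouring T e t'.+1 e_sym isT.
have [F [F1 F2 F3 F4]] := layered_forest f e_sym eX d0.
exists F; split=> //; rewrite -Et -/n in F4.
move: F4; set Delta := \sum_(v in X) \sum_(j < _) _; set delta := \sum_(v in X) _ in dev *.
move=> F4.
pose a v : R := (\sum_(u | e v u) 1)%N%:R.
have a_le v : a v <= n by rewrite ler_nat sum1_card max_card.
(* The colouring bound says that the total variance of the colour degrees is at most the sum of all
   degrees. *)
have var : \sum_v \sum_(j < t'.+1) ((cdeg e f j v)%:R - a v / t) ^+ 2 <= n ^+ 2.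
  have E v : \sum_(j < t'.+1) ((cdeg e f j v)%:R - a v / t) ^+ 2 =
      \sum_(j < t'.+1) (cdeg e f j v)%:R ^+ 2 - a v ^+ 2 / t.
    have sa : \sum_(j < t'.+1) (cdeg e f j v)%:R = a v by rewrite -natr_sum sum_cdeg.
    under eq_bigr => j _ do rewrite sqrrB.
    rewrite big_split /= sumrB sumr_const card_ord.
    rewrite sumrMnl -mulr_suml sa -[_ *+ t'.+1]mulr_natl -Et.
    by rewrite mulr2n; field; rewrite gt_eqF.
  under eq_bigr => v _ do rewrite E.
  rewrite sumrB -mulr_suml.
  move: Hf; rewrite -(ler_nat R) natrM -Et !natr_sum.
  under eq_bigr => v _ do rewrite natr_sum.
  under [X in _ <= X]eq_bigr => v _ do rewrite natrM natrD -/(a v) -Et mulrDr -expr2.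
  under eq_bigr => v _ do under eq_bigr => j _ do rewrite natrX.
  rewrite big_split /= -mulr_suml.
  set s1 := \sum_v _; set s2 := \sum_v _; set s3 := \sum_v _ => H.
  have s3n : s3 <= n ^+ 2.
    rewrite expr2 mulr_natl -sumr_const; exact: ler_sum.
  have : s1 <= (s2 + s3 * t) / t by rewrite ler_pdivlMr // mulrC.
  rewrite mulrDl mulfK ?gt_eqF //; lra.
have DeltaB : Delta <= t * e1 * n ^+ 2 + n / e1 + eps * n ^+ 2.
  apply: (@le_trans _ _ (\sum_(v in X) (\sum_(j < t'.+1) `|(cdeg e f j v)%:R - a v / t| + `|a v - d|))).
    apply: ler_sum => v _.
    have -> : `|a v - d| = \sum_(j < t'.+1) (`|a v - d| / t).
      by rewrite sumr_const card_ord -[_ *+ _]mulr_natr -Et mulfVK // gt_eqF.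
    rewrite -big_split /=; apply: ler_sum => j _.
    have -> : `|a v - d| / t = `|a v / t - d / t|.
      by rewrite -mulrBl normrM [`|t^-1|]gtr0_norm // invr_gt0.
    by rewrite (le_trans _ (ler_normD _ _)) // addrA subrK.
  rewrite big_split /=; apply: lerD => //.
  have en0 : 0 < e1 * n by rewrite mulr_gt0.
  apply: (@le_trans _ _ (\sum_v \sum_(j < t'.+1) (e1 * n + ((cdeg e f j v)%:R - a v / t) ^+ 2 / (e1 * n)))).
    apply: (@le_trans _ _ (\sum_v \sum_(j < t'.+1) `|(cdeg e f j v)%:R - a v / t|)).
      rewrite [leLHS]big_mkcond /=; apply: ler_sum => v _.
      by case: ifP => // _; apply: sumr_ge0.
    apply: ler_sum => v _; apply: ler_sum => j _; exact: norm_le_sqr.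
  have -> : \sum_v \sum_(j < t'.+1) (e1 * n + ((cdeg e f j v)%:R - a v / t) ^+ 2 / (e1 * n)) =
     t * e1 * n ^+ 2 + (\sum_v \sum_(j < t'.+1) ((cdeg e f j v)%:R - a v / t) ^+ 2) / (e1 * n).
    under eq_bigr => v _ do rewrite big_split /= sumr_const card_ord -mulr_suml.
    rewrite big_split /= sumr_const -mulr_suml -[_ *+ t'.+1]mulr_natl -Et -[_ *+ #|_|]mulr_natl.
    by rewrite -/n; congr (_ + _); ring.
  rewrite lerD2l; apply: (@le_trans _ _ (n ^+ 2 / (e1 * n))).
    by rewrite ler_wpM2r // invr_ge0 ltW.
  by have -> : n ^+ 2 / (e1 * n) = n / e1 by field; rewrite !gt_eqF.
rewrite -(ler_pM2r d0); apply: le_trans F4 _.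
have Dt : n * (d / t) <= eta / 2 * n * d.
  have -> : n * (d / t) = t^-1 * (n * d) by ring.
  by rewrite -[leRHS]mulrA ler_wpM2r // mulr_ge0 ?ltW.
have kd : k * n ^+ 2 <= eta / 2 * n * d.
  have -> : k * n ^+ 2 = (eta / 2 * n) * (c * n) by rewrite /k; ring.
  by rewrite ler_wpM2l // mulr_ge0 ?divr_ge0 // ltW.
have H1 : (2 * t + 1) * (t * e1) = k / 4.
  by rewrite /e1; field; rewrite !gt_eqF //; lra.
have H2 : (2 * t + 2) * eps = k / 4.
  by rewrite /eps; field; rewrite !gt_eqF //; lra.
have H3 : (2 * t + 1) * (n / e1) <= k / 4 * n ^+ 2.
  have : (4 * (2 * t + 1) / (e1 * k)) * (k * n / 4) <= n * (k * n / 4).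
    by rewrite ler_wpM2r // divr_ge0 // mulr_ge0 // ltW.
  have -> : (4 * (2 * t + 1) / (e1 * k)) * (k * n / 4) = (2 * t + 1) * (n / e1).
    by field; rewrite !gt_eqF.
  by have -> : n * (k * n / 4) = k / 4 * n ^+ 2 by ring.
have H4 : (2 * t + 1) * Delta <= (2 * t + 1) * (t * e1 * n ^+ 2 + n / e1 + eps * n ^+ 2).
  by rewrite ler_wpM2l //; lra.
have kn : 0 <= k * n ^+ 2 by rewrite mulr_ge0 ?exprn_ge0 // ltW.
have H5 : (2 * t + 1) * (t * e1 * n ^+ 2 + n / e1 + eps * n ^+ 2) =
   (2 * t + 1) * (t * e1) * n ^+ 2 + (2 * t + 1) * (n / e1) + ((2 * t + 2) * eps * n ^+ 2 - eps * n ^+ 2).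
  by ring.
rewrite H1 H2 in H5.
by lra.
Qed.

(** * Random reserves *)

Section Rounding.
Variables (R : realFieldType) (T : finType).
Implicit Types (x y : {ffun T -> R}) (Phi Psi : {ffun T -> R} -> R) (u v w : T).

Definition upd x v (a : R) : {ffun T -> R} := [ffun w => if w == v then a else x w].

(** Affine in coordinate [v], written as interpolation between 0 and 1. If this holds for every [v],
    the value at the constant point [p] is the expectation under independent sampling with
    probability [p]. *)
Definition affine_at v Phi :=
  forall x, Phi x = x v * Phi (upd x v 1) + (1 - x v) * Phi (upd x v 0).

Definition indep_at v Phi := forall x a, Phi (upd x v a) = Phi x.

(** Method of conditional expectations: at a coordinate equal to [p] the value is a convex
    combination of those at 0 and 1, so one of the two does not increase [Phi]. *)
Lemma multiaffine_rounding Phi (p : R) : 0 <= p <= 1 ->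
  (forall v, affine_at v Phi) ->
  exists U : {set T}, Phi [ffun v => (v \in U)%:R] <= Phi [ffun=> p].
Proof.
move=> /andP[p0 p1] affPhi.
suff [y [y1 y2]] : exists y, (forall v, (y v == 0) || (y v == 1)) /\ Phi y <= Phi [ffun=> p].
  exists [set v | y v == 1]; have -> // : [ffun v => (v \in [set v | y v == 1])%:R] = y.
  apply/ffunP => v; rewrite ffunE inE.
  by have /orP[/eqP->|/eqP->] := y1 v; rewrite ?eqxx // eq_sym oner_eq0.
suff [y [y1 _ y3]] : exists y, [/\ forall v, v \in enum T -> (y v == 0) || (y v == 1),
    forall v, v \notin enum T -> y v = p & Phi y <= Phi [ffun=> p]].
  by exists y; split=> // v; apply: y1; rewrite mem_enum.
elim: (enum T) => [|v s [y [y1 y2 y3]]].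
  by exists [ffun=> p]; split=> // v _; rewrite ffunE.
have [vs|vs] := boolP (v \in s).
  exists y; split=> // w; rewrite inE; first by case: eqP => [-> _|_ /y1//]; apply: y1.
  by rewrite negb_or => /andP[_ /y2].
suff [a a01 Ha] : exists2 a : R, (a == 0) || (a == 1) & Phi (upd y v a) <= Phi y.
  exists (upd y v a); split.
  - move=> w; rewrite inE ffunE; case: eqP => //= _; exact: y1.
  - by move=> w; rewrite inE negb_or ffunE => /andP[/negbTE-> /y2].
  - exact: le_trans Ha y3.
have := affPhi v y; rewrite (y2 v vs) => E.
have [le|lt] := leP (Phi (upd y v 1)) (Phi (upd y v 0)).
  by exists 1; rewrite ?eqxx ?orbT // E; nra.
by exists 0; rewrite ?eqxx // E; nra.
Qed.

Lemma indep_affine v Phi : indep_at v Phi -> affine_at v Phi.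
Proof. by move=> H x; rewrite !H; ring. Qed.

Lemma affineD v Phi Psi : affine_at v Phi -> affine_at v Psi ->
  affine_at v (fun x => Phi x + Psi x).
Proof. by move=> H1 H2 x; rewrite H1 H2; ring. Qed.

Lemma affineM v Phi Psi : affine_at v Phi -> indep_at v Psi ->
  affine_at v (fun x => Phi x * Psi x).
Proof. by move=> H1 H2 x; rewrite H1 !H2; ring. Qed.

Lemma affineZ v (a : R) Phi : affine_at v Phi -> affine_at v (fun x => a * Phi x).
Proof. by move=> H x; rewrite {1}H; ring. Qed.

Lemma affine_sum v (I : finType) (P : pred I) (F : I -> {ffun T -> R} -> R) :
  (forall i, P i -> affine_at v (F i)) -> affine_at v (fun x => \sum_(i | P i) F i x).
Proof.
move=> H x; rewrite !mulr_sumr -big_split /=; apply: eq_bigr => i Pi; exact: H.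
Qed.

Lemma indep_prod v (I : finType) (P : pred I) (F : I -> {ffun T -> R} -> R) :
  (forall i, P i -> indep_at v (F i)) -> indep_at v (fun x => \prod_(i | P i) F i x).
Proof. by move=> H x a; apply: eq_bigr => i Pi; apply: H. Qed.

Lemma affine_prod v (I : finType) (P : pred I) (F : I -> {ffun T -> R} -> R) i0 :
  affine_at v (F i0) -> (forall i, P i -> i != i0 -> indep_at v (F i)) ->
  affine_at v (fun x => \prod_(i | P i) F i x).
Proof.
move=> H0 H; have [Pi0|Pi0] := boolP (P i0).
  move=> x; rewrite !(bigD1 i0 Pi0) /=.
  apply: (affineM H0 (Psi := fun x => \prod_(i | P i && (i != i0)) F i x)).
  by apply: indep_prod => i /andP[]; apply: H.
apply/indep_affine/indep_prod => i Pi; apply: H => //.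
by apply: contraTneq Pi => ->.
Qed.

Lemma indep_coord v w : w != v -> indep_at v (fun x => x w).
Proof. by move=> wv x a; rewrite ffunE (negbTE wv). Qed.

Lemma affine_coord v w : affine_at v (fun x => x w).
Proof.
have [->|wv] := eqVneq w v; last exact/indep_affine/indep_coord.
by move=> x; rewrite !ffunE eqxx; ring.
Qed.

Lemma affine_monomial v (S : {set T}) : affine_at v (fun x => \prod_(w in S) x w).
Proof.
by apply: (@affine_prod v T (mem S) (fun w x => x w) v) => [|w _]; [apply: affine_coord|apply: indep_coord].
Qed.

Lemma indep_monomial v (S : {set T}) : v \notin S -> indep_at v (fun x => \prod_(w in S) x w).
Proof.
move=> vS; apply: (indep_prod (F := fun w x => x w)) => w wS; apply: indep_coord.
by apply: contraNneq vS => <-.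
Qed.

(** By disjointness at most one factor involves the coordinate [v]. *)
Lemma affine_packing v M (S : 'I_M -> {set T}) :
  (forall j j', j != j' -> [disjoint S j & S j']) ->
  affine_at v (fun x => \prod_(j < M) (1 - (\prod_(w in S j) x w) / 2)).
Proof.
move=> dis.
have aff j : affine_at v (fun x => 1 - (\prod_(w in S j) x w) / 2).
  by move=> x; rewrite {1}(@affine_monomial v (S j) x) /=; field.
have [/existsP[j0 vj0]|none] := boolP [exists j, v \in S j].
  apply: (@affine_prod v _ xpredT (fun j x => 1 - (\prod_(w in S j) x w) / 2) j0) => // j _ jj0.
  move=> x a; rewrite (indep_monomial _ x a) //.
  by apply/negP => vj; have := dis _ _ jj0; rewrite disjoint_subset => /subsetP/(_ _ vj); rewrite inE vj0.
apply/indep_affine.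
apply: (@indep_prod v _ xpredT (fun j x => 1 - (\prod_(w in S j) x w) / 2)) => j _ x a.
rewrite (indep_monomial _ x a) //; apply: contra none => vj; by apply/existsP; exists j.
Qed.

Lemma affine_pair v u w : u != w -> affine_at v (fun x => x u * x w).
Proof.
move=> uw; have [<-|wv] := eqVneq w v; last by apply: affineM; [apply: affine_coord|apply: indep_coord].
by move=> x; rewrite !ffunE eqxx (negbTE uw); ring.
Qed.

End Rounding.

(* The expectation of each of the three summands of [Phi] under independent
   sampling with probability [p] is at most [1/4]. *)
Lemma random_reserve (R : realFieldType) (T : finType) (e : rel T) (d : nat) (p : R)
    (I : finType) (M L b : nat) (S : I -> 'I_M -> {set T}) :
  0 < p < 1 -> (0 < #|T|)%N ->
  (forall v, #|[pred u | e v u]| = d) ->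
  (forall i j, (#|S i j| <= L)%N) ->
  (forall i j j', j != j' -> [disjoint S i j & S i j']) ->
  #|I|%:R * 2 ^+ b * (1 - p ^+ L / 2) ^+ M <= 1 / 4 ->
  exists U : {set T},
    [/\ #|U|%:R <= 4 * p * #|T|%:R,
        \sum_v ((\sum_(u | e v u) (u \in U))%N%:R - p * d%:R) ^+ 2 <= 4 * #|T|%:R ^+ 2 &
        forall i, (b < #|[set j | S i j \subset U]|)%N].
Proof.
move=> /andP[p0 p1] T0 ed SL Sdis small.
pose n : R := #|T|%:R.
have n0 : 0 < n by rewrite ltr0n.
have dn : d%:R <= n.
  have /card_gt0P[v _] := T0; by rewrite ler_nat -(ed v) max_card.
(* The square of [\sum_(u | e v u) x u - p * d] with every [x u ^+ 2] replaced by [x u]: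
   multiaffine, and unchanged at 0/1 points. *)
pose Q v (x : {ffun T -> R}) :=
  \sum_(u | e v u) \sum_(w | e v w && (w != u)) x u * x w +
  ((1 - 2 * p * d%:R) * \sum_(u | e v u) x u + (p * d%:R) ^+ 2).
(* At a 0/1 point a summand is [2 ^+ b] halved once for each [S i j] inside the sampled set; a value
   below 1 means more than [b] of them. *)
pose Phi1 (x : {ffun T -> R}) :=
  \sum_i 2 ^+ b * \prod_(j < M) (1 - (\prod_(w in S i j) x w) / 2).
pose Phi2 (x : {ffun T -> R}) := (4 * n ^+ 2)^-1 * \sum_v Q v x.
pose Phi3 (x : {ffun T -> R}) := (4 * p * n)^-1 * \sum_v x v.
pose Phi x := Phi1 x + (Phi2 x + Phi3 x).
have affPhi v : affine_at v Phi.
  apply: affineD.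
    apply: affine_sum => i _; apply: affineZ; exact: affine_packing (Sdis i).
  apply: affineD; apply: affineZ; apply: affine_sum => u _; last exact: affine_coord.
  apply: affineD.
    apply: affine_sum => w _; apply: affine_sum => w' /andP[_ ww']; apply: affine_pair.
    by rewrite eq_sym.
  apply: affineD; last by apply: indep_affine => x a.
  by apply: affineZ; apply: affine_sum => w _; apply: affine_coord.
have [|U HU] := multiaffine_rounding _ affPhi (p := p); first by rewrite !ltW.
have P1 : Phi1 [ffun=> p] <= 1 / 4.
  apply: le_trans small; rewrite /Phi1 -mulrA [leRHS]mulr_natl -sumr_const.
  apply: ler_sum => i _; rewrite ler_wpM2l ?exprn_ge0 //.
  have -> : (1 - p ^+ L / 2) ^+ M = \prod_(j < M) (1 - p ^+ L / 2).
    by rewrite prodr_const card_ord.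
  apply: ler_prod => j _.
  under eq_bigr => w _ do rewrite ffunE.
  rewrite prodr_const.
  have q1 : p ^+ #|S i j| <= 1 by rewrite exprn_ile1 // ltW.
  have q2 : p ^+ L <= p ^+ #|S i j| by rewrite ler_wiXn2l // ltW.
  by apply/andP; split; lra.
have P2 : Phi2 [ffun=> p] <= 1 / 4.
  rewrite /Phi2 mulrC ler_pdivrMr ?mulr_gt0 ?exprn_gt0 //.
  have -> : 1 / 4 * (4 * n ^+ 2) = n ^+ 2 by field.
  rewrite expr2 [leRHS]mulr_natl -sumr_const; apply: ler_sum => v _.
  apply: le_trans dn.
  have E1 : \sum_(u | e v u) [ffun=> p] u = p * d%:R :> R.
    under eq_bigr => u _ do rewrite ffunE.
    by rewrite sumr_const ed mulr_natr.
  have E2 : \sum_(u | e v u) \sum_(w | e v w && (w != u)) ([ffun=> p] u * [ffun=> p] w : R) =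
      d%:R * (p ^+ 2 * (d%:R - 1)).
    have inner u : e v u ->
        \sum_(w | e v w && (w != u)) ([ffun=> p] u * [ffun=> p] w : R) = p ^+ 2 * (d%:R - 1).
      move=> evu; under eq_bigr => w _ do rewrite !ffunE -expr2.
      rewrite sumr_const -[LHS]mulr_natr; congr (_ * _).
      rewrite -(ed v) [in RHS](cardD1 u) inE evu natrD [1%:R + _]addrC addrK.
      by congr (_%:R); apply: eq_card => w; rewrite !inE andbC.
    by rewrite (eq_bigr _ inner) sumr_const ed -[LHS]mulr_natl.
  rewrite /Q E1 E2.
  have : 0 <= d%:R :> R by [].
  by move: (d%:R : R) => dd dd0; nra.
have P3 : Phi3 [ffun=> p] <= 1 / 4.
  rewrite /Phi3; under eq_bigr => w _ do rewrite ffunE.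
  rewrite sumr_const -[_ *+ _]mulr_natr -/n.
  by rewrite le_eqVlt; apply/orP; left; apply/eqP; field; rewrite !gt_eqF.
pose xU : {ffun T -> R} := [ffun v => (v \in U)%:R].
have Phi1_ge0 i : 0 <= 2 ^+ b * \prod_(j < M) (1 - (\prod_(w in S i j) xU w) / 2) :> R.
  rewrite mulr_ge0 ?exprn_ge0 //; apply: prodr_ge0 => j _.
  have : \prod_(w in S i j) xU w <= 1 :> R.
    apply: prodr_ile1 => w _; rewrite ffunE.
    by case: (w \in U); rewrite ?ler01 ?lexx.
  by lra.
have QE v : Q v xU = ((\sum_(u | e v u) (u \in U))%N%:R - p * d%:R) ^+ 2.
  have -> : (\sum_(u | e v u) (u \in U))%N%:R = \sum_(u | e v u) xU u :> R.
    by rewrite natr_sum; apply: eq_bigr => u _; rewrite ffunE.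
  rewrite /Q; set s := \sum_(u | e v u) xU u.
  have -> : \sum_(u | e v u) \sum_(w | e v w && (w != u)) xU u * xU w = s ^+ 2 - s.
    rewrite expr2 {1}/s mulr_suml /s -sumrB; apply: eq_bigr => u evu.
    rewrite [X in xU u * X](bigD1 u evu) /= mulrDr mulr_sumr.
    have -> : xU u * xU u = xU u.
      by rewrite ffunE; case: (u \in U); rewrite ?mulr1 ?mulr0.
    by rewrite addrAC subrr add0r.
  by ring.
have Phi2_ge0 : 0 <= Phi2 xU.
  rewrite /Phi2 mulr_ge0 ?invr_ge0 ?mulr_ge0 ?exprn_ge0 ?(ltW n0) //.
  by apply: sumr_ge0 => v _; rewrite QE sqr_ge0.
have Phi3_ge0 : 0 <= Phi3 xU.
  rewrite /Phi3 mulr_ge0 ?invr_ge0 ?mulr_ge0 ?(ltW n0) ?(ltW p0) //.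
  by apply: sumr_ge0 => v _; rewrite ffunE.
have Phi1S : 0 <= Phi1 xU by apply: sumr_ge0.
(* The three summands are nonnegative at [xU], so each is below 1; each gives one of the three
   claims. *)
have lt1 : Phi1 xU + (Phi2 xU + Phi3 xU) <= 3 / 4.
  by apply: le_trans HU _; rewrite /Phi; lra.
exists U; split.
- have : Phi3 xU <= 1 by lra.
  rewrite /Phi3 mulrC ler_pdivrMr ?mulr_gt0 // mul1r; apply: le_trans.
  under eq_bigr => w _ do rewrite ffunE.
  by rewrite -natr_sum ler_nat -sum1_card big_mkcond; apply: leq_sum => w _; case: (w \in U).
- have : Phi2 xU <= 1 by lra.
  rewrite /Phi2 mulrC ler_pdivrMr ?mulr_gt0 ?exprn_gt0 // mul1r; apply: le_trans.
  by apply: ler_sum => v _; rewrite QE.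
- move=> i.
  have : 2 ^+ b * \prod_(j < M) (1 - (\prod_(w in S i j) xU w) / 2) < 1 :> R.
    apply: (@le_lt_trans _ _ (Phi1 xU)); last by lra.
    by rewrite /Phi1 (bigD1 i) //= lerDl; apply: sumr_ge0.
  have -> : \prod_(j < M) (1 - (\prod_(w in S i j) xU w) / 2) =
      2 ^- #|[set j | S i j \subset U]| :> R.
    rewrite -exprVn -prodr_const [RHS]big_mkcond /=; apply: eq_bigr => j _.
    rewrite inE; case: ifPn => [sub|/subsetPn[w wS wU]].
      rewrite big1 => [|w wS]; first by field.
      by rewrite ffunE (subsetP sub _ wS).
    by rewrite (bigD1 w wS) /= ffunE (negbTE wU) mul0r mul0r subr0.
  rewrite ltr_pdivrMr ?exprn_gt0 // mul1r ltr_eXn2l //.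
  by rewrite ltr1n.
Qed.

(** * Splittings and robust links *)

(** A chord shortcuts the path, so repeated shortening ends without chords. *)
Lemma chordless_path (T : finType) (e : rel T) (u v : T) : connect e u v ->
  exists p, [/\ path e u p, last u p = v &
    forall i j, (i.+1 < j)%N -> (j <= size p)%N ->
      ~~ e (nth u (u :: p) i) (nth u (u :: p) j)].
Proof.
case/connectP=> p0 pth0 ->; have [N] := ubnP (size p0).
elim: N p0 pth0 => // N IH p pth ltN.
have [/existsP[i /existsP[j /andP[ij eij]]]|none] := boolP [exists i : 'I_(size p).+1,
    exists j : 'I_(size p).+1, (i.+1 < j)%N && e (nth u (u :: p) i) (nth u (u :: p) j)].
  have jp : (j <= size p)%N by rewrite -ltnS.
  case: j ij eij jp => -[|j] //= _ ij eij jp.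
  have ip : (i < size p)%N by lia.
  have dropE : drop j p = nth u p j :: drop j.+1 p by rewrite (drop_nth u).
  have lastE : last u (take i p) = nth u (u :: p) i.
    rewrite (last_nth u) size_take ip.
    case: (i : nat) ip => [|k] kp //=.
    by rewrite nth_take.
  have lastd : last u (take i p ++ drop j p) = last u p.
    by rewrite last_cat -[in RHS](cat_take_drop j p) last_cat dropE.
  rewrite -lastd; apply: IH.
    rewrite cat_path take_path //= lastE dropE /= eij /=.
    have := pth; rewrite -{1}(cat_take_drop j p) cat_path dropE /=.
    by case/and3P.
  by rewrite size_cat size_take ip size_drop; lia.
exists p; split=> // i j ij jp; apply: contra none => eij.
have ip : (i < (size p).+1)%N by lia.
apply/existsP; exists (Ordinal ip); apply/existsP.
by exists (Ordinal (jp : (j < (size p).+1)%N)); rewrite /= ij.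
Qed.

Section Splitting.
Variables (R : realType) (G : sgraph) (d : nat) (A B : {set G}).
Implicit Types u v w x y z : G.
Hypothesis reg : forall u : G, degree u = d.
Hypothesis AB : forall u v : G, adj u v -> u \in A -> v \in B.
Hypothesis BA : forall u v : G, adj u v -> u \in B -> v \in A.

Definition codeg (u v : G) : nat := (\sum_(x : G) adj u x * adj v x)%N.

Lemma sum_adj u : (\sum_(x : G) adj u x)%N = d.
Proof.
rewrite -(reg u) /degree -sum1_card [RHS]big_mkcond; apply: eq_bigr => x _.
by rewrite inE; case: adj.
Qed.

Lemma sum_codeg u : (\sum_w codeg u w)%N = (d * d)%N.
Proof.
rewrite /codeg exchange_big /= -{1}(sum_adj u) big_distrl /=; apply: eq_bigr => x _.
by rewrite -big_distrr /=; under eq_bigr => w _ do rewrite adj_sym; rewrite sum_adj.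
Qed.

(** If [X x] of the [s i] are adjacent to [x], then [2 * X x] is at most 2 plus the number of
    ordered pairs of distinct indices among them, and [X x] is 0 outside [B]. Summing over [x] gives
    the bound. *)
Lemma codeg_independent k (s : 'I_k -> G) : (forall i, s i \in A) ->
  (2 * (k * d) <= 2 * #|B| + \sum_(i < k) \sum_(j < k | j != i) codeg (s i) (s j))%N.
Proof.
move=> sA; pose X x := (\sum_(i < k) adj (s i) x)%N.
have XX : (\sum_x X x)%N = (k * d)%N.
  rewrite /X exchange_big /=; under eq_bigr => i _ do rewrite sum_adj.
  by rewrite sum_nat_const card_ord.
have -> : (\sum_(i < k) \sum_(j < k | j != i) codeg (s i) (s j))%N =
    (\sum_x \sum_(i < k) \sum_(j < k | j != i) adj (s i) x * adj (s j) x)%N.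
  rewrite [RHS]exchange_big /=; apply: eq_bigr => i _.
  by rewrite [RHS]exchange_big.
rewrite -XX big_distrr /= -sum1_card big_distrr /= [X in (_ <= X + _)%N]big_mkcond /= -big_split /=.
apply: leq_sum => x _.
have sq : (X x * X x = X x + \sum_(i < k) \sum_(j < k | j != i) adj (s i) x * adj (s j) x)%N.
  rewrite {1 3}/X big_distrl /= -big_split /=; apply: eq_bigr => i _.
  rewrite /X (bigD1 i) //= mulnDr big_distrr /=; congr (_ + _)%N.
  by case: adj.
have XB : (0 < X x)%N -> x \in B.
  rewrite lt0n; apply: contraNT => xB; rewrite /X big1 // => i _.
  by apply/eqP; rewrite eqb0; apply: contra xB => /AB; apply.
move: sq XB; set Y := (\sum_(i < k) _)%N; case: (x \in B); first by nia.
by case: (X x) => [|m] sq => [|/(_ isT)].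
Qed.

Let n : R := #|G|%:R.

(** The codegrees from [u] sum to [d ^+ 2]; a vertex of the counted set contributes at most [n], any
    other at most [a]. *)
Lemma many_close u (a : R) : 0 <= a ->
  d%:R ^+ 2 <= #|[set w | a <= (codeg u w)%:R]|%:R * n + a * n.
Proof.
move=> a0; set W := [set w | _].
have -> : d%:R ^+ 2 = \sum_w (codeg u w)%:R :> R by rewrite -natr_sum sum_codeg expr2 natrM.
rewrite (bigID (mem W)) /=; apply: lerD.
  rewrite mulr_natl -sumr_const; apply: ler_sum => w _; rewrite ler_nat.
  rewrite /codeg -sum1_card; apply: leq_sum => x _.
  by case: adj; case: adj.
apply: (@le_trans _ _ (\sum_(w | w \notin W) a)).
  by apply: ler_sum => w; rewrite inE -ltNge => /ltW.
by rewrite sumr_const -mulr_natr ler_wpM2l // ler_nat max_card.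
Qed.

(* [l] labels the vertices of [A] outside [D]; values elsewhere are irrelevant. *)
Definition splitting (k : nat) (delta : R) (D : {set G}) (l : G -> nat) : Prop :=
  [/\ #|D|%:R <= delta * n,
      forall i, (i < k)%N -> exists u, [/\ u \in A, u \notin D & l u = i],
      forall u, u \in A -> u \notin D -> (l u < k)%N &
      forall u v, u \in A -> u \notin D -> v \in A -> v \notin D -> l u != l v ->
        (codeg u v)%:R < delta * n].

Section Robust.
Variables (c delta delta' eta : R) (k q : nat) (D : {set G}) (l : G -> nat).
Hypotheses (c_gt0 : 0 < c) (n_gt0 : 0 < n) (cd : c * n <= d%:R).
Hypotheses (delta_gt0 : 0 < delta) (eta_ge0 : 0 <= eta).
Hypothesis delta'_ge : delta + eta <= delta'.
Hypothesis delta'_small : delta + delta' < c ^+ 2.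
Hypothesis Dl : splitting k delta D l.
Hypothesis maxk : forall D' l', ~ splitting k.+1 delta' D' l'.
(** By [codeg_independent], this excludes [q.+1] vertices of [A] with pairwise codegrees at most
    [delta' * n]. *)
Hypothesis few : 2 * (#|B|%:R : R) + q.+1%:R ^+ 2 * (delta' * n) < 2 * (q.+1%:R * d%:R).

(** More than [(delta + eta) * n] vertices are close to [u], too many for [D :|: D']. A close vertex
    shares a neighbour with [u], hence lies in [A]; outside [D] it must have the label of [u]. *)
Lemma class_large u (D' : {set G}) : u \in A -> u \notin D -> #|D'|%:R <= eta * n ->
  exists w, [/\ w \in A, w \notin D, w \notin D' & l w = l u].
Proof.
move=> uA uD D'n; have [Dn _ _ cross] := Dl.
have dn0 : 0 < delta * n by rewrite mulr_gt0.
have := many_close u (ltW dn0); set W := [set w | _] => big.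
have cd2 : (c * n) ^+ 2 <= d%:R ^+ 2.
  by rewrite ler_sqr ?nnegrE // mulr_ge0 // ltW.
have [W0|/subsetPn[w wW]] := boolP (W \subset D :|: D'); last first.
  rewrite !inE in wW *; rewrite negb_or => /andP[wD wD'].
  have wA : w \in A.
    have : (0 < codeg u w)%N by rewrite -(ltr_nat R); apply: lt_le_trans wW.
    rewrite lt0n; apply: contraNT => wA; rewrite /codeg big1 // => x _.
    case ux: (adj u x); case wx: (adj w x) => //; case/negP: wA.
    by apply: (BA (u := x)); [rewrite adj_sym|apply: AB ux uA].
  exists w; split=> //; apply/eqP; apply: contraTT wW => lwu.
  by rewrite -ltNge; apply: cross => //; rewrite eq_sym.
have : #|W|%:R <= #|D|%:R + #|D'|%:R :> R.
  by rewrite -natrD ler_nat (leq_trans (subset_leq_card W0)) // leq_card_setU.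
move=> W1; have W2 : #|W|%:R <= (delta + eta) * n by lra.
have : (c * n) ^+ 2 <= (delta + eta) * n * n + delta * n * n.
  apply: le_trans cd2 _; apply: le_trans big _; rewrite lerD2r.
  by rewrite ler_wpM2r // ltW.
have n2 : 0 < n ^+ 2 by rewrite exprn_gt0.
have -> : (delta + eta) * n * n + delta * n * n = (delta + eta + delta) * n ^+ 2 by ring.
rewrite exprMn ler_pM2r // leNgt => /negP[]; apply: le_lt_trans delta'_small.
by rewrite [leRHS]addrC lerD2r.
Qed.

(** Otherwise the part of the class unreachable from [u] could take the new label [k], giving [k.+1]
    classes at tolerance [delta'] after deletion of [D :|: D'], against [maxk]. The other classes
    stay nonempty by [class_large]. *)
Lemma robust_connect u v (D' : {set G}) :
  u \in A -> u \notin D -> u \notin D' -> v \in A -> v \notin D -> v \notin D' ->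
  l u = l v -> #|D'|%:R <= eta * n ->
  connect [rel x y | [&& x \in A :\: D :\: D', y \in A :\: D :\: D' &
                        delta' * n <= (codeg x y)%:R]] u v.
Proof.
move=> uA uD uD' vA vD vD' luv D'n; set e := [rel x y | _]; apply: contraT => uv.
have [Dn surj lk cross] := Dl.
have dd' : delta * n <= delta' * n.
  by rewrite ler_wpM2r ?(ltW n_gt0) //; move: delta'_ge eta_ge0; lra.
pose l' w := if (l w == l u) && ~~ connect e u w then k else l w.
case: (@maxk (D :|: D') l'); split.
- apply: (@le_trans _ _ (#|D|%:R + #|D'|%:R)).
    by rewrite -natrD ler_nat leq_card_setU.
  apply: (@le_trans _ _ ((delta + eta) * n)); first by lra.
  by rewrite ler_wpM2r // ltW.
- move=> i; rewrite ltnS leq_eqVlt => /orP[/eqP->|ik].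
    by exists v; rewrite inE negb_or vA vD vD' /l' luv eqxx uv.
  have [iu|iu] := eqVneq i (l u).
    exists u; rewrite inE negb_or uA uD uD' /l' eqxx connect0; split=> //.
  have [z [zA zD lz]] := surj i ik.
  have [w [wA wD wD' lw]] := class_large zA zD D'n.
  by exists w; rewrite inE negb_or wA wD wD' /l' lw lz (negbTE iu).
- move=> w wA; rewrite inE negb_or => /andP[wD _]; rewrite /l'.
  by case: ifP => // _; rewrite ltnS ltnW // lk.
- move=> x y xA; rewrite inE negb_or => /andP[xD xD'] yA.
  rewrite inE negb_or => /andP[yD yD'].
  have [lxy|lxy] := eqVneq (l x) (l y); last first.
    by move=> _; apply: lt_le_trans dd'; apply: cross.
  have sep a b : a \in A :\: D :\: D' -> b \in A :\: D :\: D' ->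
      connect e u a -> ~~ connect e u b -> (codeg a b)%:R < delta' * n.
    move=> aW bW ua; apply: contraNT; rewrite -leNgt => ab.
    by apply: connect_trans ua (connect1 _); rewrite /= aW bW.
  have xW : x \in A :\: D :\: D' by rewrite !inE xD xD' xA.
  have yW : y \in A :\: D :\: D' by rewrite !inE yD yD' yA.
  rewrite /l' -lxy; case: (l x == l u) => /=; last by rewrite eqxx.
  case ux: (connect e u x); case uy: (connect e u y); rewrite /= ?eqxx // => _.
    by apply: sep => //; rewrite uy.
  suff -> : codeg x y = codeg y x by apply: sep => //; rewrite ux.
  by apply: eq_bigr => z _; rewrite mulnC.
Qed.

(** Alternate vertices of a chordless path of close vertices are pairwise far, so by [few] it has at
    most [2 * q] edges. Each edge becomes two through a common neighbour outside [D'], available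
    since [eta < delta']. *)
Lemma robust_link u v (D' : {set G}) :
  u \in A -> u \notin D -> u \notin D' -> v \in A -> v \notin D -> v \notin D' ->
  u != v -> l u = l v -> #|D'|%:R <= eta * n ->
  exists p, [/\ path (@adj G) u (rcons p v), uniq (u :: rcons p v),
                (size p <= 4 * q)%N & forall x, x \in p -> x \notin D'].
Proof.
move=> uA uD uD' vA vD vD' neq luv D'n.
have := robust_connect uA uD uD' vA vD vD' luv D'n.
set e := [rel x y | _]; case/chordless_path=> p [pth lastp chord].
have uW : u \in A :\: D :\: D' by rewrite !inE uD uD' uA.
have e_sym : symmetric e.
  move=> x y /=; rewrite andbA [(x \in _) && _]andbC -andbA; congr [&& _, _ & _ <= _%:R].
  by apply: eq_bigr => z _; rewrite mulnC.
have pW : all (mem (A :\: D :\: D')) (u :: p).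
  rewrite /= uW /=; elim: (p) (u) pth => //= y r IH x /andP[/and3P[_ yW _] /IH ->].
  by rewrite yW.
have sp : (size p <= 2 * q)%N.
  rewrite leqNgt; apply/negP => qp.
  pose s (i : 'I_q.+1) := nth u (u :: p) (2 * i).
  have si (i : 'I_q.+1) : s i \in A :\: D :\: D'.
    by apply: (allP pW); apply: mem_nth; rewrite /= ltnS (leq_trans _ (ltnW qp)) // leq_mul2l /= -ltnS.
  have sA i : s i \in A by have := si i; rewrite !inE => /and3P[].
  have nadj i j : i != j -> ~~ e (s i) (s j).
    wlog ij : i j / (i < j)%N => [H|_].
      rewrite -val_eqE neq_ltn => /orP[ij|ij]; first by apply: H => //; rewrite -val_eqE ltn_eqF.
      have -> : e (s i) (s j) = e (s j) (s i) by exact: e_sym.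
      by apply: H => //; rewrite -val_eqE ltn_eqF.
    apply: chord; last by rewrite (leq_trans _ (ltnW qp)) // leq_mul2l /= -ltnS.
    by rewrite -[(2 * i).+2]/((2 + 2 * i)%N) -mulnS leq_mul2l.
  have := codeg_independent sA; apply/negP; rewrite -ltnNge -(ltr_nat R).
  rewrite natrD !natrM; apply: le_lt_trans few; rewrite lerD2l natr_sum.
  rewrite expr2 -mulrA mulr_natl -[X in _ *+ X]card_ord -sumr_const; apply: ler_sum => i _.
  rewrite natr_sum mulr_natl -[X in _ *+ X]card_ord -sumr_const big_mkcond /=.
  apply: ler_sum => j _; case: ifP => [ij|_]; last first.
    by rewrite mulr_ge0 // ?(ltW n_gt0) //; move: delta'_ge eta_ge0 delta_gt0; lra.
  have := nadj i j; rewrite eq_sym ij => /(_ isT); rewrite /= !si /= -ltNge => /ltW.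
  by [].
have walk : forall r x, path e x r ->
    exists r', [/\ path (@adj G) x r', last x r' = last x r, size r' = (2 * size r)%N &
                   forall y, y \in r' -> y \notin D'].
  elim=> [|y r IH] x /=; first by move=> _; exists [::].
  case/andP=> /and3P[xW yW xy] /IH[r' [r1 r2 r3 r4]].
  have [z [xz yz zD']] : exists z, [/\ adj x z, adj y z & z \notin D'].
    have [sub|/subsetPn[z]] := boolP ([set z | adj x z && adj y z] \subset D').
      have : (codeg x y <= #|D'|)%N.
        apply: leq_trans (subset_leq_card sub).
        rewrite -sum1_card [X in (_ <= X)%N]big_mkcond /=; apply: leq_sum => z _.
        by rewrite inE; case: adj; case: adj.
      rewrite -(ler_nat R) => H; have : delta' * n <= eta * n by lra.
      by rewrite ler_pM2r // leNgt => /negP[]; move: delta'_ge delta_gt0; lra.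
    by rewrite inE => /andP[xz yz] zD'; exists z.
  exists (z :: y :: r'); split=> //=.
  - by rewrite xz adj_sym yz.
  - by rewrite r3 mulnS.
  - move=> w; rewrite !inE => /or3P[/eqP->|/eqP->|/r4] //.
    by move: yW; rewrite !inE => /andP[].
have [r [r1 r2 r3 r4]] := walk p u pth.
have : last u r = v by rewrite r2.
(* The chosen common neighbours may coincide with each other or with vertices of the path, so the
   walk is shortened to a path. *)
case/shortenP: r1 => r' r'1 r'2 sub; case/lastP: r' r'1 r'2 sub => [|r' v'] r'1 r'2 sub.
  by move=> /= uv; rewrite uv eqxx in neq.
rewrite last_rcons => E; subst v'; exists r'; split=> //.
  have : (size (rcons r' v) <= size r)%N.
    by apply: uniq_leq_size; [case/andP: r'2|move=> z /sub].
  by rewrite size_rcons r3 => /ltnW/leq_trans; apply; rewrite -[4%N]/(2 * 2)%N -mulnA leq_mul2l.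
by move=> x xr; apply/r4/sub; rewrite mem_rcons inE xr orbT.
Qed.

Definition linked (u v : G) (S : {set G}) : Prop :=
  exists p, [/\ path (@adj G) u (rcons p v), uniq (u :: rcons p v) & {subset p <= S}].

Lemma linking_family u v M :
  u \in A -> u \notin D -> v \in A -> v \notin D -> u != v -> l u = l v ->
  (M * (4 * q))%:R <= eta * n ->
  exists S : 'I_M -> {set G},
    [/\ forall j, (#|S j| <= 4 * q)%N,
        forall j j', j != j' -> [disjoint S j & S j'] &
        forall j, linked u v (S j)].
Proof.
move=> uA uD vA vD neq luv.
(* Greedy choice: [robust_link] avoids the union of the earlier sets. These must also miss [u] and
   [v], as the next link has its ends there. *)
suff H : (M * (4 * q))%:R <= eta * n -> exists S : nat -> {set G},
    [/\ forall j, (j < M)%N -> (#|S j| <= 4 * q)%N,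
        forall j j', (j < M)%N -> (j' < M)%N -> j != j' -> [disjoint S j & S j'],
        forall j, (j < M)%N -> (u \notin S j) && (v \notin S j) &
        forall j, (j < M)%N -> linked u v (S j)].
  by case/H=> S [S1 S2 S3 S4]; exists S; split=> [j|j j'|j]; auto.
elim: M => [|M IH] HM.
  by exists (fun=> set0).
have [|S [S1 S2 S3 S4]] := IH.
  by apply: le_trans HM; rewrite ler_nat leq_mul2r leqnSn orbT.
pose D' := \bigcup_(j < M) S j.
have D'u : u \notin D' by apply/bigcupP => -[j _]; have /andP[/negbTE->] := S3 j (ltn_ord j).
have D'v : v \notin D' by apply/bigcupP => -[j _]; have /andP[_ /negbTE->] := S3 j (ltn_ord j).
have D'n : #|D'|%:R <= eta * n.
  apply: le_trans HM; rewrite ler_nat (@leq_trans (M * (4 * q))) //; last by rewrite leq_mul2r leqnSn orbT.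
  apply: (@leq_trans (\sum_(j < M) #|S j|)).
    rewrite /D'; elim/big_rec2: _ => [|i a b _ H]; first by rewrite cards0.
    by apply: leq_trans (leq_card_setU _ _) _; rewrite leq_add2l.
  apply: (@leq_trans (\sum_(j < M) (4 * q))); first by apply: leq_sum => j _; apply: S1.
  by rewrite sum_nat_const card_ord.
have [p [p1 p2 p3 p4]] := robust_link uA uD D'u vA vD D'v neq luv D'n.
have newdis j : (j < M)%N -> [disjoint S j & [set x in p]].
  move=> jM; rewrite disjoint_sym disjoint_subset; apply/subsetP => x; rewrite inE => /p4.
  rewrite inE; apply: contra => xj; apply/bigcupP; by exists (Ordinal jM).
exists (fun j => if j == M then [set x in p] else S j); split.
- move=> j; rewrite ltnS leq_eqVlt; case: eqP => [_ _|_] /=; last exact: S1.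
  by rewrite cardsE (leq_trans (card_size _)).
- move=> j j'; rewrite !ltnS (leq_eqVlt j) (leq_eqVlt j').
  case: (eqVneq j M) => [->|_] /=; case: (eqVneq j' M) => [->|_] //=.
  + by move=> _ /newdis H _; rewrite disjoint_sym.
  + by move=> /newdis.
  + exact: S2.
- move=> j; rewrite ltnS leq_eqVlt; case: eqP => [_ _|_] /=; last exact: S3.
  move: p2; rewrite /= mem_rcons inE negb_or rcons_uniq !inE.
  by case/andP=> /andP[_ ->] /andP[->].
- move=> j; rewrite ltnS leq_eqVlt; case: eqP => [_ _|_] /=; last exact: S4.
  by exists p; split=> // x; rewrite inE.
Qed.

End Robust.
End Splitting.

(** * The subgraph respecting the labels *)

Section LabelGraph.
Variables (R : realType) (G : sgraph) (d k : nat) (A B D : {set G}) (l : G -> nat).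
Variables (c delta : R).
Hypothesis reg : forall u : G, degree u = d.
Hypothesis BA : forall u v : G, adj u v -> u \in B -> v \in A.
Hypothesis c_gt0 : 0 < c.
Hypothesis G_gt0 : (0 < #|G|)%N.
Hypothesis cd : c * #|G|%:R <= d%:R.
Hypothesis delta_small : delta <= c / 2.
Hypothesis delta_ge0 : 0 <= delta.
Hypothesis Dl : splitting A k delta D l.

(* [m y] is meant to be the label of most neighbours of [y]. *)
Definition lost (m : G -> nat) (y z : G) : bool :=
  [&& y \in B, adj y z, z \notin D & l z != m y].

(** For the best label, [#|N y| * lo y (m y)] is at most the number of ordered pairs of neighbours
    of [y] outside [D] with different labels. Over all [y] in [B] these pairs are counted by
    codegrees across classes, each below [delta * n], while [#|N y|] is at least [c / 2 * n]. *)
Lemma majority_label : exists m : G -> nat,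
  (\sum_y \sum_z lost m y z)%N%:R <= 2 * delta / c * #|G|%:R ^+ 2.
Proof.
pose N y := [set z | adj y z && (z \notin D)].
pose lo y i := (\sum_(z in N y) (l z != i))%N.
have /fin_all_exists[m Hm] : forall y, exists i,
    (#|N y| * lo y i <= \sum_(z in N y) lo y (l z))%N.
  move=> y; have [->|[z0 z0N]] := set_0Vmem (N y); first by exists 0%N; rewrite cards0.
  pose z1 := [arg min_(z < z0 in N y) lo y (l z)].
  exists (l z1); rewrite -sum_nat_const; apply: leq_sum => z zN.
  by rewrite /z1; case: arg_minnP => // w _; apply.
exists m.
have lostE y : (\sum_z lost m y z)%N = ((y \in B) * lo y (m y))%N.
  rewrite /lo /lost big_distrr [RHS]big_mkcond /=; apply: eq_bigr => z _.
  by rewrite inE; case: (y \in B); case: adj; case: (z \notin D); rewrite ?muln0 ?mul1n ?mul0n.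
pose n : R := #|G|%:R; have n0 : 0 < n by rewrite ltr0n.
have [Dn _ _ cross] := Dl.
have Nbig y : c / 2 * n <= #|N y|%:R.
  have : (d <= #|N y| + #|D|)%N.
    rewrite -(reg y) /degree -(cardsID D) addnC leq_add //; last exact/subset_leq_card/subsetIr.
    by apply/subset_leq_card/subsetP => z; rewrite !inE andbC.
  rewrite -(ler_nat R) natrD.
  have : delta * n <= c / 2 * n by rewrite ler_wpM2r // ltW.
  by move: cd Dn; rewrite -/n; lra.
have tot : (\sum_y \sum_z lost m y z)%N%:R * (c / 2 * n) <=
    (\sum_y (y \in B) * \sum_(z in N y) lo y (l z))%N%:R.
  rewrite !natr_sum mulr_suml; apply: ler_sum => y _.
  rewrite lostE !natrM -mulrA ler_wpM2l //.
  apply: (@le_trans _ _ (#|N y| * lo y (m y))%N%:R); last by rewrite ler_nat.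
  by rewrite natrM mulrC ler_wpM2r.
have pairs : (\sum_y (y \in B) * \sum_(z in N y) lo y (l z) <=
    \sum_(z in A :\: D) \sum_(w in A :\: D | l w != l z) codeg z w)%N.
  rewrite /codeg.
  under [X in (_ <= X)%N]eq_bigr => z _ do rewrite exchange_big /=.
  rewrite [X in (_ <= X)%N]exchange_big /=; apply: leq_sum => y _.
  have [yB|] := boolP (y \in B); last by rewrite mul0n.
  rewrite mul1n [X in (X <= _)%N]big_mkcond [X in (_ <= X)%N]big_mkcond /=.
  apply: leq_sum => z _; case: ifP => // zN.
  have zAD : z \in A :\: D.
    by move: zN; rewrite !inE => /andP[yz ->]; rewrite (BA yz yB).
  rewrite zAD /lo [X in (X <= _)%N]big_mkcond [X in (_ <= X)%N]big_mkcond /=.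
  apply: leq_sum => w _; case: ifP => // wN.
  have wAD : w \in A :\: D.
    by move: wN; rewrite !inE => /andP[yz ->]; rewrite (BA yz yB).
  rewrite wAD /=; case: (l w != l z) => //.
  by move: zN wN; rewrite !inE => /andP[zy _] /andP[wy _]; rewrite (adj_sym z) (adj_sym w) zy wy.
have up : (\sum_(z in A :\: D) \sum_(w in A :\: D | l w != l z) codeg z w)%N%:R <= delta * n * n ^+ 2.
  rewrite natr_sum; apply: (@le_trans _ _ (\sum_(z : G) \sum_(w : G) (delta * n))).
    rewrite big_mkcond /=; apply: ler_sum => z _; case: ifP => zAD; last first.
      by apply: sumr_ge0 => w _; rewrite mulr_ge0 // ltW.
    rewrite natr_sum big_mkcond /=; apply: ler_sum => w _; case: ifP => [/andP[wAD lwz]|_].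
      move: zAD wAD; rewrite !inE => /andP[zD zA] /andP[wD wA].
      by apply/ltW/cross => //; rewrite eq_sym.
    by rewrite mulr_ge0 // ltW.
  by rewrite !sumr_const -[leLHS]mulr_natr -[X in X * _ <= _]mulr_natr -/n expr2 mulrA.
have {tot} : (\sum_y \sum_z lost m y z)%N%:R * (c / 2 * n) <= delta * n * n ^+ 2.
  by apply: le_trans tot (le_trans _ up); rewrite ler_nat.
rewrite -ler_pdivlMr ?mulr_gt0 ?invr_gt0 //.
have -> : delta * n * n ^+ 2 / (c / 2 * n) = 2 * delta / c * n ^+ 2.
  by field; rewrite !gt_eqF.
exact.
Qed.

(** Around a [B]-vertex all remaining neighbours share the label that [m] assigns to it, which is
    what trimming needs; imposing this at both ends keeps the relation symmetric. *)
Definition label_rel (m : G -> nat) (U : {set G}) : rel G := fun u v =>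
  [&& adj u v, u \in ~: (U :|: D), v \in ~: (U :|: D),
      (u \in B) ==> (l v == m u) & (v \in B) ==> (l u == m v)].

(** About [p * d] neighbours of [v] fall into [U]; the other losses are neighbours in [D] and edges
    [lost] in either direction. *)
Lemma label_graph_degree (m : G -> nat) (U : {set G}) (p : R) (v : G) :
  v \in ~: (U :|: D) ->
  `|(\sum_(u | label_rel m U v u) 1)%N%:R - (1 - p) * d%:R| <=
    `|(\sum_(u | adj v u) (u \in U))%N%:R - p * d%:R| + (\sum_(u in D) adj v u)%N%:R +
    (\sum_u lost m v u)%N%:R + (\sum_u lost m u v)%N%:R.
Proof.
move=> vX; set e := label_rel m U.
have -> : (\sum_(u | e v u) 1 = \sum_u e v u)%N.
  by rewrite big_mkcond; apply: eq_bigr => u _; case: (e v u).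
have -> : (\sum_(u | adj v u) (u \in U) = \sum_u (adj v u && (u \in U)))%N.
  by rewrite big_mkcond; apply: eq_bigr => u _; case: adj.
have -> : (\sum_(u in D) adj v u = \sum_u (adj v u && (u \in D)))%N.
  by rewrite big_mkcond; apply: eq_bigr => u _; case: (u \in D); rewrite ?andbT ?andbF.
have dE : (\sum_u adj v u)%N = d by apply: sum_adj.
set a := (\sum_u e v u)%N; set b := (\sum_u _)%N; set f := (\sum_u _)%N.
set g := (\sum_u lost m v u)%N; set h := (\sum_u lost m u v)%N.
have lo : (a + b <= d)%N.
  rewrite -dE -big_split /=; apply: leq_sum => u _.
  rewrite /e /label_rel !inE !negb_or; case: adj => //=; case: (u \in U); rewrite ?andbF //=.
  by rewrite addn0 leq_b1.
have hi : (d <= a + b + f + g + h)%N.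
  rewrite -dE -!big_split /=; apply: leq_sum => u _.
  rewrite /e /label_rel /lost vX [adj u v]adj_sym !inE !negb_or.
  move: vX; rewrite !inE negb_or => /andP[_ ->].
  case: adj => //=; case: (u \in U) => //=; case: (u \in D) => //=.
  by case: (v \in B); case: (u \in B); case: (l u == m v); case: (l v == m u).
have Ra : a%:R + b%:R <= d%:R :> R by rewrite -natrD ler_nat.
have Rd : d%:R <= a%:R + b%:R + f%:R + g%:R + h%:R :> R by rewrite -!natrD ler_nat.
have -> : a%:R - (1 - p) * d%:R = - (b%:R - p * d%:R) + (a%:R + b%:R - d%:R) :> R by ring.
apply: le_trans (ler_normD _ _) _; rewrite normrN -!addrA lerD2l ler0_norm; lra.
Qed.

Lemma label_graph_deviation (m : G -> nat) (U : {set G}) (p eps1 : R) :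
  0 < eps1 ->
  \sum_v ((\sum_(u | adj v u) (u \in U))%N%:R - p * d%:R) ^+ 2 <= 4 * #|G|%:R ^+ 2 ->
  (\sum_y \sum_z lost m y z)%N%:R <= 2 * delta / c * #|G|%:R ^+ 2 ->
  \sum_(v in ~: (U :|: D)) `|(\sum_(u | label_rel m U v u) 1)%N%:R - (1 - p) * d%:R| <=
    (eps1 + delta + 4 * delta / c) * #|G|%:R ^+ 2 + 4 / eps1 * #|G|%:R.
Proof.
move=> e10 var lostm; pose n : R := #|G|%:R; have n0 : 0 < n by rewrite ltr0n.
rewrite -/n in var lostm *.
pose Z v := `|(\sum_(u | adj v u) (u \in U))%N%:R - p * d%:R| + (\sum_(u in D) adj v u)%N%:R +
    (\sum_u lost m v u)%N%:R + (\sum_u lost m u v)%N%:R.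
apply: (@le_trans _ _ (\sum_v Z v)).
  rewrite [leLHS]big_mkcond /=; apply: ler_sum => v _; case: ifP => vX.
    exact: label_graph_degree.
  by rewrite /Z !addr_ge0.
rewrite /Z !big_split /= -!natr_sum [X in _ + X%:R](exchange_big _ _ _ _) /=.
have en0 : 0 < eps1 * n by rewrite mulr_gt0.
have S1 : \sum_v `|(\sum_(u | adj v u) (u \in U))%N%:R - p * d%:R| <= eps1 * n ^+ 2 + 4 / eps1 * n.
  apply: le_trans (ler_sum _ (fun v _ => norm_le_sqr _ en0)) _.
  rewrite big_split /= sumr_const -mulr_suml -[_ *+ _]mulr_natr -/n; apply: lerD.
    by rewrite expr2 mulrA.
  rewrite ler_pdivrMr //.
  by have -> : 4 / eps1 * n * (eps1 * n) = 4 * n ^+ 2 by field; rewrite gt_eqF.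
have S2 : (\sum_v \sum_(u in D) adj v u)%N%:R <= delta * n ^+ 2.
  rewrite exchange_big /=; have [Dn _ _ _] := Dl.
  apply: (@le_trans _ _ (#|D|%:R * n)); last by rewrite expr2 mulrA ler_wpM2r // ltW.
  rewrite -natrM ler_nat -sum_nat_const; apply: leq_sum => u _.
  by rewrite -sum1_card; apply: leq_sum => v _; apply: leq_b1.
have -> : 4 * delta / c = 2 * delta / c + 2 * delta / c by field; rewrite gt_eqF.
by rewrite !mulrDl; move: S1 S2 lostm; lra.
Qed.

End LabelGraph.

(** * Covering by few paths *)

(** By Bernoulli's inequality, [(1 - x) ^+ s <= 1 / (1 + s * x)]. *)
Lemma expr_to0 (R : realType) (x a : R) : 0 < x < 1 -> 0 < a ->
  exists2 s : nat, (0 < s)%N & (1 - x) ^+ s <= a.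
Proof.
move=> /andP[x0 x1] a0.
have bern s : (1 - x) ^+ s * (1 + s%:R * x) <= 1.
  elim: s => [|s IH]; first by rewrite expr0 mul0r addr0 mulr1.
  apply: le_trans IH; rewrite exprSr -mulrA ler_wpM2l ?exprn_ge0 ?subr_ge0 ?ltW //.
  rewrite -natr1; have : 0 <= s%:R :> R by [].
  by move: (s%:R : R) => t t0; nra.
pose s := (Num.truncn (1 / (a * x))).+1; exists s => //.
have H : 1 / (a * x) < s%:R by apply: truncnS_gt.
have sx : 0 < 1 + s%:R * x by rewrite ltr_pwDl // mulr_ge0 // ltW.
have := bern s; rewrite -ler_pdivlMr // => /le_trans; apply.
rewrite ler_pdivrMr //.
have : 1 < s%:R * (a * x) by rewrite -ltr_pdivrMr ?mulr_gt0.
by nra.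
Qed.

(** With [a] the quotient of [b] by 4, [b < 4 * a.+1 <= 4 * 2 ^ a]. It serves to beat the number
    [n ^ 2] of pairs by [2 ^ b], where [b] is linear in [n]. *)
Lemma quartic_lt_exp2 (b : nat) : (b ^ 4 < 4 ^ 4 * 2 ^ b)%N.
Proof.
have eb := divn_eq b 4; have rb := ltn_pmod b (isT : (0 < 4)%N).
set a := (b %/ 4)%N in eb; set r := (b %% 4)%N in eb rb.
have le : (b < 4 * a.+1)%N by lia.
have le2 : (a.+1 <= 2 ^ a)%N by apply: ltn_expl.
apply: (@leq_trans ((4 * a.+1) ^ 4)); first by rewrite ltn_exp2r.
rewrite expnMn leq_mul // (@leq_trans ((2 ^ a) ^ 4)) ?leq_exp2r //.
by rewrite -expnM leq_exp2l // eb leq_addr.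
Qed.

Definition near_path_cover (R : realType) (G : sgraph) (q : nat) (alpha : R) : Prop :=
  exists P : seq (seq G),
    [/\ disjoint_paths P, (size P <= q)%N & #|uncovered P|%:R <= alpha * #|G|%:R].

Lemma disjoint_paths_flatten (G : sgraph) (P : seq (seq G)) :
  uniq (flatten P) -> all (fun p => (p != [::]) && sorted (@adj G) p) P -> disjoint_paths P.
Proof.
elim: P => //= p P IH; rewrite cat_uniq => /and3P[up dis uP] /andP[/andP[p0 sp] aP].
have /andP[H1 H2] := IH uP aP.
rewrite /disjoint_paths /= H1 H2 /is_path p0 sp up /= andbT.
apply/allP => r rP; rewrite disjoint_has; apply: contra dis => /hasP[x xp xr].
by apply/hasP; exists x => //; apply/flattenP; exists r.
Qed.

(* The common frame of both parts: [A = B = V], or [A] and [B] the two sides. *)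
Record regular_between (R : realType) (c beta : R) (G : sgraph) (d : nat) (A B : {set G}) : Prop := {
  between_reg : forall u : G, degree u = d;
  between_deg : c * #|G|%:R <= d%:R;
  between_AB : forall u v : G, adj u v -> u \in A -> v \in B;
  between_BA : forall u v : G, adj u v -> u \in B -> v \in A;
  between_cover : forall u : G, (u \in A) || (u \in B);
  between_card : #|B|%:R <= beta * #|G|%:R }.

(** Each element of [Q] spoils at most one of the disjoint sets. *)
Lemma disjoint_from_small (T : finType) (M : nat) (S : 'I_M -> {set T}) (J : {set 'I_M}) (Q : {set T}) :
  (forall j j', j != j' -> [disjoint S j & S j']) -> (#|Q| < #|J|)%N ->
  exists2 j, j \in J & [disjoint S j & Q].
Proof.
move=> dis QJ; apply/exists_inP; apply: contraLR QJ => /exists_inPn none; rewrite -leqNgt.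
have meet j : j \in J -> exists x, (x \in Q) && (x \in S j).
  by move/none; rewrite -setI_eq0 => /set0Pn[x]; rewrite inE andbC; exists x.
apply: (@leq_trans (\sum_(x in Q) 1)); last by rewrite sum1_card.
rewrite -sum1_card.
apply: (@leq_trans (\sum_(j in J) \sum_(x in Q) (x \in S j))%N).
  apply: leq_sum => j /meet[x /andP[xQ xS]].
  by rewrite (bigD1 x) //= xS.
rewrite exchange_big /=; apply: leq_sum => x xQ.
have [/exists_inP[j jJ xj]|no] := boolP [exists j in J, x \in S j].
  rewrite (bigD1 j) //= big1 ?addn0 ?leq_b1 // => j' /andP[_ jj'].
  have := dis _ _ jj'; rewrite disjoint_sym disjoint_subset => /subsetP/(_ _ xj).
  by rewrite inE => /negbTE->.
rewrite big1 // => j jJ; apply/eqP; rewrite eqb0.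
by move/exists_inPn: no => /(_ j jJ).
Qed.

Lemma cover_of_maximal_splitting (R : realType) (c alpha beta delta' : R) (q : nat) :
  0 < c -> 0 < alpha -> 0 < delta' -> 2 * delta' < c ^+ 2 ->
  2 * beta + q.+1%:R ^+ 2 * delta' < 2 * (q.+1%:R * c) ->
  exists2 delta : R, 0 < delta & exists n0 : nat,
  forall (G : sgraph) (d k : nat) (A B D : {set G}) (l : G -> nat),
    regular_between c beta d A B -> (n0 <= #|G|)%N -> (k <= q)%N ->
    splitting A k delta D l -> (forall D' l', ~ splitting A k.+1 delta' D' l') ->
    near_path_cover G q alpha.
Proof.
move=> c0 alpha0 delta'0 delta'_small few.
(* The uncovered vertices lie in [U], in [D] or are trimmed off; [4 * p], [delta] and [2 * eta1]
   will each be at most [alpha / 4]. *)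
pose p := Num.min (alpha / 16) (1 / 2).
have p0 : 0 < p by rewrite lt_min !divr_gt0.
have p12 : p <= 1 / 2 by rewrite ge_min lexx orbT.
have pa : p <= alpha / 16 by rewrite ge_min lexx.
pose L := (4 * q)%N; pose eta := delta' / 2.
have eta0 : 0 < eta by rewrite divr_gt0.
have pL : 0 < p ^+ L / 2 < 1.
  have : p ^+ L <= 1 by rewrite exprn_ile1 ?ltW //; lra.
  by have : 0 < p ^+ L by [rewrite exprn_gt0]; lra.
(* With [s * b] candidate links per pair, the weight [2 ^+ b] is outdone: each unit of [b]
   contributes a factor at most [2 * (1 / 4)]. *)
have [s s0 Hs] := expr_to0 pL (a := 1 / 4) ltac:(by rewrite divr_gt0).
(* [kap] lets [s * b] disjoint links of size [L] fit into [eta * n]; [eta1] keeps the cost of all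
   merges, [L] per path, below [kap * n / 2 <= b]. *)
pose kap := eta / (s%:R * L.+1%:R).
have kap0 : 0 < kap by rewrite divr_gt0 // mulr_gt0 ?ltr0n.
pose eta1 := Num.min (kap / (2 * L.+1%:R)) (alpha / 8).
have eta10 : 0 < eta1 by rewrite lt_min !divr_gt0 ?mulr_gt0 ?ltr0n.
have eta1k : eta1 <= kap / (2 * L.+1%:R) by rewrite ge_min lexx.
have eta1a : eta1 <= alpha / 8 by rewrite ge_min lexx orbT.
have [eps eps0 [n2 forest]] := near_regular_forest (divr_gt0 c0 (ltr0n R 2)) eta10.
pose delta := Num.min (Num.min eta (alpha / 4)) (Num.min (c / 2) (eps / (2 * (1 + 4 / c)))).
have c4 : 0 < 1 + 4 / c by rewrite addr_gt0 ?divr_gt0.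
have delta0 : 0 < delta by rewrite !lt_min eta0 !divr_gt0 ?mulr_gt0.
have d1 : delta <= eta by rewrite !ge_min lexx.
have d2 : delta <= alpha / 4 by rewrite !ge_min lexx orbT.
have d3 : delta <= c / 2 by rewrite !ge_min lexx !orbT.
have d4 : delta * (1 + 4 / c) <= eps / 2.
  have : delta <= eps / (2 * (1 + 4 / c)) by rewrite !ge_min lexx !orbT.
  by rewrite ler_pdivlMr ?mulr_gt0 //; lra.
exists delta => //.
(* [n3] absorbs the linear term of the degree deviation, [n4] the truncation in [b], and [n5] yields
   [4 * n ^ 2 <= 2 ^ b]. *)
pose n3 := (Num.truncn (64 / eps ^+ 2)).+1.
pose n4 := (Num.truncn (2 / kap)).+1.
pose n5 := (Num.truncn (2 * 8 ^+ 2 / kap ^+ 2)).+1.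
exists (maxn n2 (maxn n3 (maxn n4 n5))) => G d k A B D l [reg cd AB BA cover Bb].
rewrite !geq_max => /and4P[Gn2 Gn3 Gn4 Gn5] kq Dl maxk.
have G0 : (0 < #|G|)%N by apply: leq_trans Gn3.
pose n : R := #|G|%:R; have n0 : 0 < n by rewrite ltr0n.
rewrite -/n in cd Bb.
have big (x : R) m : (Num.truncn x).+1 = m -> (m <= #|G|)%N -> x <= n.
  move=> <- H; apply/ltW; apply: lt_le_trans (truncnS_gt x) _; by rewrite ler_nat.
have nn3 : 64 / eps ^+ 2 <= n by apply: (big _ n3).
have nn4 : 2 / kap <= n by apply: (big _ n4).
have nn5 : 2 * 8 ^+ 2 / kap ^+ 2 <= n by apply: (big _ n5).
pose b := Num.truncn (kap * n); pose M := (s * b)%N.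
have kn0 : 0 <= kap * n by rewrite mulr_ge0 // ltW.
have b_le : b%:R <= kap * n by rewrite truncn_le.
have b_ge : kap * n / 2 <= b%:R.
  have : kap * n < b.+1%:R by apply: truncnS_gt.
  have : 2 <= kap * n by rewrite mulrC -ler_pdivrMr.
  by rewrite -[b.+1%:R]natr1; lra.
have ML : (M * L)%:R <= eta * n.
  rewrite natrM /M natrM.
  have -> : eta = kap * (s%:R * L.+1%:R).
    by rewrite /kap mulfVK // mulf_neq0 ?pnatr_eq0 -?lt0n.
  have -> : kap * (s%:R * L.+1%:R) * n = s%:R * (kap * n * L.+1%:R) by ring.
  rewrite -mulrA ler_wpM2l //; apply: ler_pM => //; by rewrite ler_nat.
have fewG : 2 * #|B|%:R + q.+1%:R ^+ 2 * (delta' * n) < 2 * (q.+1%:R * d%:R).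
  have H1 : q.+1%:R * (c * n) <= q.+1%:R * d%:R by rewrite ler_wpM2l.
  have H2 : (2 * beta + q.+1%:R ^+ 2 * delta') * n < 2 * (q.+1%:R * c) * n by rewrite ltr_pM2r.
  by lra.
have fam (u v : G) : exists S : 'I_M -> {set G},
    [/\ forall j, (#|S j| <= L)%N,
        forall j j', j != j' -> [disjoint S j & S j'] &
        u \in A -> u \notin D -> v \in A -> v \notin D -> u != v -> l u = l v ->
        forall j, linked u v (S j)].
  have [/and5P[uA uD vA vD /andP[neq /eqP luv]]|no] :=
      boolP [&& u \in A, u \notin D, v \in A, v \notin D & (u != v) && (l u == l v)].
    have [||S [S1 S2 S3]] := linking_family reg AB BA c0 n0 cd delta0 (ltW eta0) _ _ Dl maxk fewG uA uD vA vD neq luv ML.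
    - by rewrite /eta in d1 *; lra.
    - by rewrite /eta in d1; lra.
    by exists S.
  (* Pairs that need no link get empty sets, so the reserve can be drawn for all of [G * G]. *)
  exists (fun=> set0); split=> [j|j j' _|uA uD vA vD neq luv].
  - by rewrite cards0.
  - by rewrite -setI_eq0 setI0.
  - by case/negP: no; rewrite uA uD vA vD neq luv eqxx.
have /fin_all_exists[S0 HS0] : forall uv : G * G, exists S : 'I_M -> {set G},
    [/\ forall j, (#|S j| <= L)%N,
        forall j j', j != j' -> [disjoint S j & S j'] &
        uv.1 \in A -> uv.1 \notin D -> uv.2 \in A -> uv.2 \notin D -> uv.1 != uv.2 ->
        l uv.1 = l uv.2 -> forall j, linked uv.1 uv.2 (S j)].
  by move=> [u v]; apply: fam.
have smallp : #|{: G * G}|%:R * 2 ^+ b * (1 - p ^+ L / 2) ^+ M <= 1 / 4.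
  rewrite card_prod natrM -/n /M exprM.
  have H1 : ((1 - p ^+ L / 2) ^+ s) ^+ b <= (1 / 4) ^+ b.
    by apply: lerXn2r; rewrite ?nnegrE ?divr_ge0 ?exprn_ge0 //; lra.
  apply: (@le_trans _ _ (n * n * 2 ^+ b * (1 / 4) ^+ b)).
    by rewrite ler_wpM2l // mulr_ge0 ?exprn_ge0 // mulr_ge0 // ltW.
  rewrite -mulrA -exprMn.
  have -> : 2 * (1 / 4) = 2^-1 :> R by field.
  rewrite exprVn ler_pdivrMr ?exprn_gt0 //.
  pose y := kap * n / 2 / 4; have y0 : 0 <= y by rewrite !divr_ge0.
  have H2 : y ^+ 4 <= 2 ^+ b.
    apply: (@le_trans _ _ ((b%:R / 4) ^+ 4)).
      by apply: lerXn2r; rewrite ?nnegrE ?divr_ge0 // ler_wpM2r ?invr_ge0.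
    rewrite expr_div_n ler_pdivrMr ?exprn_gt0 // mulrC.
    by rewrite -!natrX -natrM ler_nat ltnW // quartic_lt_exp2.
  have H3 : 2 * n <= y ^+ 2.
    have : (2 * 8 ^+ 2 / kap ^+ 2) * (kap ^+ 2 * n / 8 ^+ 2) <= n * (kap ^+ 2 * n / 8 ^+ 2).
      by rewrite ler_wpM2r // divr_ge0 ?exprn_ge0 // mulr_ge0 ?exprn_ge0 // ltW.
    have -> : (2 * 8 ^+ 2 / kap ^+ 2) * (kap ^+ 2 * n / 8 ^+ 2) = 2 * n.
      by field; rewrite gt_eqF.
    by have -> : n * (kap ^+ 2 * n / 8 ^+ 2) = y ^+ 2 by rewrite /y; field.
  have : (2 * n) ^+ 2 <= (y ^+ 2) ^+ 2.
    by apply: lerXn2r; rewrite ?nnegrE ?exprn_ge0 // mulr_ge0 // ltW.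
  rewrite -exprM exprMn => H4; rewrite -expr2.
  by move: H4 H2; move: (n ^+ 2) (y ^+ 4) (2 ^+ b : R) => x z w; lra.
have [||||U [U1 U2 U3]] := @random_reserve R G (@adj G) d p _ M L b (fun uv => S0 uv) _ G0 _ _ _ smallp.
- by rewrite p0 /=; lra.
- by move=> v; rewrite -(reg v) /degree cardsE.
- by move=> i j; have [+ _ _] := HS0 i; apply.
- by move=> i j j'; have [_ + _] := HS0 i; apply.
rewrite -/n in U1 U2.
have [m Hm] := majority_label reg BA c0 G0 cd d3 (ltW delta0) Dl.
have dev := label_graph_deviation reg c0 G0 Dl (eps1 := eps / 4) (divr_gt0 eps0 (ltr0n R 4)) U2 Hm.
pose X := ~: (U :|: D).
pose e : rel G := label_rel B D l m U.
have e_sym : symmetric e.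
  move=> u v; rewrite /e /label_rel adj_sym; congr (_ && _).
  by rewrite andbCA; congr (_ && _); congr (_ && _); rewrite andbC.
have eX u v : e u v -> v \in X by case/and5P.
have [||F [F1 F2 F3 F4]] := forest G e X ((1 - p) * d%:R) e_sym eX Gn2.
- rewrite -/n; have H : (1 - p) * (c * n) <= (1 - p) * d%:R by rewrite ler_wpM2l //; lra.
  apply: le_trans H; rewrite mulrA ler_wpM2r ?(ltW n0) //.
  have : p * c <= 1 / 2 * c by rewrite ler_wpM2r // ltW.
  by lra.
- apply: le_trans dev _; rewrite -/n.
  have H1 : 4 / (eps / 4) * n <= eps / 4 * n ^+ 2.
    have : 64 / eps ^+ 2 * (eps / 4 * n) <= n * (eps / 4 * n).
      by rewrite ler_wpM2r // mulr_ge0 ?divr_ge0 // ltW.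
    have -> : 64 / eps ^+ 2 * (eps / 4 * n) = 4 / (eps / 4) * n by field; rewrite gt_eqF.
    by have -> : n * (eps / 4 * n) = eps / 4 * n ^+ 2 by ring.
  have H2 : (delta * (1 + 4 / c)) * n ^+ 2 <= eps / 2 * n ^+ 2.
    by rewrite ler_wpM2r // exprn_ge0 // ltW.
  have -> : eps / 4 + delta + 4 * delta / c = eps / 4 + delta * (1 + 4 / c) by ring.
  by rewrite mulrDl; lra.
rewrite -/n in F4.
have [||||F' [T1 T2 T3 T4]] := trim_forest (lab := l) e_sym _ eX AB BA cover _ (F := F).
- by move=> u v /and5P[].
- move=> y x z yB /and5P[_ _ _ + _] /and5P[_ _ _ + _].
  by rewrite yB => /eqP-> /eqP->.
- by apply/allP => r /(allP F3)/andP[].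
- by apply/allP => x xF; rewrite /= -F2.
have inX u : u \in X -> u \notin D by rewrite !inE negb_or => /andP[].
have FX x : x \in flatten F' -> x \in X by move/(mem_subseq T1); rewrite F2.
have [||||P [P1 P2 P3 P4]] := @merge_paths G l [pred u | (u \in A) && (u \in X)] U k L b F' _ _ _ T4.
- move=> u v Q /andP[uA uX] /andP[vA vX] neq luv Qb.
  have [S1 S2 S3] := HS0 (u, v).
  have [j jJ jQ] := disjoint_from_small S2 (leq_ltn_trans Qb (U3 (u, v))).
  have [r [r1 r2 r3]] := S3 uA (inX _ uX) vA (inX _ vX) neq luv j.
  move: jJ; rewrite inE => jU.
  have ur : uniq r by move: r2; rewrite /= rcons_uniq => /and3P[].
  exists r; split=> //.
  + apply: leq_trans (S1 j); rewrite -(card_uniqP ur).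
    by apply/subset_leq_card/subsetP.
  + by move=> x /r3/(subsetP jU).
  + by move=> x /r3 xj; move: jQ; rewrite disjoint_subset => /subsetP/(_ _ xj); rewrite inE.
- by move=> u /andP[uA uX]; have [_ _ + _] := Dl; apply=> //; apply: inX.
- exact: subseq_uniq T1 F1.
(* The trimmed paths avoid [U], so the whole budget [b] is left for links. *)
- rewrite (eq_in_count (a2 := pred0)) ?count_pred0.
    rewrite add0n -(ler_nat R) natrM; apply: le_trans b_ge.
    have H1 : (size F')%:R <= eta1 * n by apply: le_trans F4; rewrite ler_nat.
    have H2 : L%:R * (size F')%:R <= L.+1%:R * (eta1 * n) by rewrite ler_pM // ler_nat.
    apply: le_trans H2 _.
    have H3 : eta1 * (L.+1%:R * n) <= kap / (2 * L.+1%:R) * (L.+1%:R * n).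
      by rewrite ler_wpM2r // mulr_ge0 // ltW.
    have -> : L.+1%:R * (eta1 * n) = eta1 * (L.+1%:R * n) by ring.
    apply: le_trans H3 _.
    have -> // : kap / (2 * L.+1%:R) * (L.+1%:R * n) = kap * n / 2.
    have := ltr0n R L.+1; move: (L.+1%:R : R) => z z0; by field; rewrite gt_eqF.
  by move=> x /FX; rewrite !inE negb_or => /andP[/negbTE].
exists P; split.
- apply: disjoint_paths_flatten => //; apply/allP => r /(allP P2).
  by case: r => //= x r /and4P[].
- exact: leq_trans P3 kq.
have unc : (#|uncovered P| <= #|U| + #|D| + (size (flatten F) - size (flatten F')))%N.
  have sub : uncovered P \subset U :|: D :|: ([set x in flatten F] :\: [set x in flatten F']).
    apply/subsetP => x; rewrite !inE => nP; rewrite F2 !inE.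
    case: ((x \in U) || (x \in D)) => //=; rewrite andbT; apply: contra nP => /P4.
    by case/flattenP=> r rP xr; apply/hasP; exists r.
  apply: leq_trans (subset_leq_card sub) _; apply: leq_trans (leq_card_setU _ _) _.
  apply: leq_add; first exact: leq_card_setU.
  rewrite cardsD (setIidPr _); last by apply/subsetP => x; rewrite !inE; apply: mem_subseq.
  by rewrite !cardsE !(card_uniqP _) // (subseq_uniq T1 F1).
have [Dn _ _ _] := Dl.
have : (#|uncovered P| <= #|U| + #|D| + 2 * size F)%N.
  by apply: leq_trans unc _; rewrite leq_add2l leq_subLR.
rewrite -(ler_nat R) natrD natrM [(#|U| + #|D|)%:R]natrD => H; apply: le_trans H _.
rewrite -/n in Dn *.
have H1 : 4 * p * n <= 4 * (alpha / 16) * n by rewrite ler_wpM2r ?(ltW n0) // ler_wpM2l.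
have H2 : delta * n <= alpha / 4 * n by rewrite ler_wpM2r ?(ltW n0).
have H3 : eta1 * n <= alpha / 8 * n by rewrite ler_wpM2r ?(ltW n0).
have H4 : 0 < alpha * n by rewrite mulr_gt0.
by lra.
Qed.

(** One representative per class would give [q.+1] pairwise far vertices of [A]. *)
Lemma no_large_splitting (R : realType) (c beta delta : R) (q : nat) (G : sgraph) (d : nat)
    (A B D : {set G}) (l : G -> nat) :
  regular_between c beta d A B -> (0 < #|G|)%N -> 0 <= delta ->
  2 * beta + q.+1%:R ^+ 2 * delta < 2 * (q.+1%:R * c) ->
  ~ splitting A q.+1 delta D l.
Proof.
move=> [reg cd AB BA cover Bb] G0 delta0 few [_ surj _ cross].
have /fin_all_exists[s Hs] (i : 'I_q.+1) := surj i (ltn_ord i).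
pose n : R := #|G|%:R; have n0 : 0 < n by rewrite ltr0n.
rewrite -/n in cd Bb cross.
have sA i : s i \in A by have [] := Hs i.
have := codeg_independent reg AB sA; apply/negP; rewrite -ltnNge -(ltr_nat R).
rewrite natrD !natrM.
have H1 : q.+1%:R * (c * n) <= q.+1%:R * d%:R by rewrite ler_wpM2l.
have H2 : (2 * beta + q.+1%:R ^+ 2 * delta) * n < 2 * (q.+1%:R * c) * n by rewrite ltr_pM2r.
suff : (\sum_(i < q.+1) \sum_(j < q.+1 | j != i) codeg (s i) (s j))%N%:R <=
    q.+1%:R ^+ 2 * (delta * n) by lra.
rewrite natr_sum expr2 -mulrA mulr_natl -[X in _ *+ X]card_ord -sumr_const; apply: ler_sum => i _.
rewrite natr_sum mulr_natl -[X in _ *+ X]card_ord -sumr_const big_mkcond /=.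
apply: ler_sum => j _; case: ifP => [ij|_]; last by rewrite mulr_ge0 // ltW.
have [_ iD li] := Hs i; have [_ jD lj] := Hs j.
apply/ltW/cross => //; rewrite li lj; by rewrite eq_sym.
Qed.

Lemma near_path_cover_of_regular (R : realType) (c alpha beta : R) (q : nat) :
  0 < c -> 0 < alpha -> beta < q.+1%:R * c ->
  exists n0 : nat, forall (G : sgraph) (d : nat) (A B : {set G}),
    regular_between c beta d A B -> A != set0 -> (n0 <= #|G|)%N -> near_path_cover G q alpha.
Proof.
move=> c0 alpha0 bq.
pose Q : R := q.+1%:R ^+ 2; have Q0 : 0 < Q by rewrite exprn_gt0 // ltr0n.
(* The second entry spends half of the slack that [beta < q.+1 * c] leaves in the doubled
   inequality. *)
pose delta0 := Num.min (c ^+ 2 / 4) ((q.+1%:R * c - beta) / Q).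
have d00 : 0 < delta0 by rewrite lt_min !divr_gt0 ?exprn_gt0 // subr_gt0.
have ok x : x <= delta0 -> 2 * x < c ^+ 2 /\ 2 * beta + Q * x < 2 * (q.+1%:R * c).
  rewrite le_min => /andP[x1]; rewrite ler_pdivlMr // mulrC => x2; split; last by lra.
  by have : 0 < c ^+ 2 by [rewrite exprn_gt0]; lra.
(* Downward induction on the number [q.+1 - j] of classes: [j = 0] is impossible, and [j = q] is a
   single class, realised by a constant label with nothing deleted. *)
have step : forall j, (j <= q)%N -> exists2 delta : R, 0 < delta <= delta0 &
    exists n0 : nat, forall (G : sgraph) (d : nat) (A B D : {set G}) (l : G -> nat),
      regular_between c beta d A B -> (n0 <= #|G|)%N -> splitting A (q.+1 - j) delta D l ->
      near_path_cover G q alpha.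
  elim=> [|j IH] jq.
    exists delta0; first by rewrite d00 lexx.
    exists 1%N => G d A B D l st G0; rewrite subn0 => Dl.
    by case: (no_large_splitting st G0 (ltW d00) _ Dl); have [] := ok _ (lexx _).
  have [delta' /andP[d'0 d'1] [n1 H1]] := IH (ltnW jq).
  have [ok1 ok2] := ok _ d'1.
  have [delta dl0 [n2 H2]] := cover_of_maximal_splitting c0 alpha0 d'0 ok1 ok2.
  have Es : (q.+1 - j = (q.+1 - j.+1).+1)%N by rewrite subSS subSn // ltnW.
  have kq : (q.+1 - j.+1 <= q)%N by rewrite subSS leq_subr.
  exists (Num.min delta delta0); first by rewrite lt_min dl0 d00 ge_min lexx orbT.
  exists (maxn n1 n2) => G d A B D l st; rewrite geq_max => /andP[G1 G2] [Dn surj lk cross].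
  have Dl : splitting A (q.+1 - j.+1) delta D l.
    have le : Num.min delta delta0 * #|G|%:R <= delta * #|G|%:R.
      by rewrite ler_wpM2r // ge_min lexx.
    split=> //; first exact: le_trans Dn le.
    by move=> u v uA uD vA vD luv; apply: lt_le_trans le; apply: cross.
  (* Either one more class is possible at tolerance [delta'] and induction applies, or the splitting
     at hand is maximal. *)
  have [[D' [l' Dl']]|none] := EM (exists D' l', splitting A (q.+1 - j) delta' D' l').
    exact: H1 st G1 Dl'.
  apply: H2 st G2 kq Dl _ => D' l' Dl'; apply: none; exists D', l'; by rewrite Es.
have [delta /andP[dl0 _] [n1 H]] := step q (leqnn q).
exists n1 => G d A B st /set0Pn[u uA] Gn.
apply: (H G d A B set0 (fun=> 0%N)) => //; rewrite subSnn; split.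
- by rewrite cards0 mulr_ge0 // ltW.
- by move=> [|i] // _; exists u; rewrite inE.
- by [].
- by move=> x y; rewrite eqxx.
Qed.

Lemma bipartite_regular_card (G : sgraph) (d : nat) (A : {set G}) :
  (0 < d)%N -> (forall u : G, degree u = d) ->
  (forall u v : G, adj u v -> (u \in A) != (v \in A)) -> #|A| = #|~: A|.
Proof.
move=> d0 reg bip; apply/eqP; rewrite -(eqn_pmul2r d0); apply/eqP.
have side (S : {set G}) : (forall u v : G, adj u v -> (u \in S) != (v \in S)) ->
    (#|S| * d = \sum_(u in S) \sum_(v in ~: S) adj u v)%N.
  move=> bipS; rewrite -sum_nat_const; apply: eq_bigr => u uS.
  rewrite -(sum_adj reg u) [RHS]big_mkcond; apply: eq_bigr => v _.
  rewrite inE; case: ifP => // vS; apply/eqP; rewrite eqb0; apply/negP => /bipS.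
  by rewrite uS (negbFE vS).
rewrite side // side; last by move=> u v /bip; rewrite !inE (inj_eq negb_inj).
rewrite setCK exchange_big /=; apply: eq_bigr => u _; apply: eq_bigr => v _.
by rewrite adj_sym.
Qed.

Theorem theorem1p2 (R : realType) (c alpha : R) (c_gt0 : 0 < c)
    (alpha_gt0 : 0 < alpha) :
  exists n0 : nat, forall n : nat, (n0 <= n)%N ->
    (forall G : sgraph, #|G| = n -> regular G (Num.ceil (c * n%:R)) ->
       exists P : seq (seq G),
         [/\ disjoint_paths P,
             Posz (size P) <= Num.floor (1 / c) &
             #|uncovered P|%:R <= alpha * n%:R])
    /\
    (forall G : sgraph, #|G| = n -> bipartite G ->
       regular G (Num.ceil (c * n%:R)) ->
       exists P : seq (seq G),
         [/\ disjoint_paths P,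
             Posz (size P) <= Num.floor (1 / (2 * c)) &
             #|uncovered P|%:R <= alpha * n%:R]).
Proof.
have cut (x y : R) (m : nat) : 0 < x -> (m <= Num.truncn (y / x))%N -> 0 <= y / x -> Posz m <= Num.floor (y / x).
  by move=> x0 mt yx; rewrite floor_ge_int // -truncn_ge_nat.
(* The integer part of [y / c] is a [q] with [y < q.+1 * c], as required of [beta]; [y] is 1 in
   general and [1 / 2] for bipartite graphs. *)
have lt_c (y : R) : 0 <= y -> y < (Num.truncn (y / c)).+1%:R * c.
  by move=> y0; rewrite -ltr_pdivrMr // truncnS_gt.
have [n1 H1] := near_path_cover_of_regular c_gt0 alpha_gt0 (lt_c 1 ler01).
have half0 : 0 <= 1 / 2 :> R by rewrite divr_ge0.
have [n2 H2] := near_path_cover_of_regular c_gt0 alpha_gt0 (lt_c (1 / 2) half0).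
have halfE : 1 / 2 / c = 1 / (2 * c) by field; rewrite gt_eqF.
rewrite halfE in H2.
exists (maxn 1 (maxn n1 n2)) => n; rewrite !geq_max => /and3P[n_gt0 n1n n2n].
have degs (G : sgraph) : #|G| = n -> regular G (Num.ceil (c * n%:R)) ->
    exists d, [/\ (0 < d)%N, forall u : G, degree u = d & c * #|G|%:R <= d%:R].
  move=> Gn reg; have /card_gt0P[u0 _] : (0 < #|G|)%N by rewrite Gn.
  have cd : c * n%:R <= (degree u0)%:R.
    by have := ceil_ge (c * n%:R); rewrite -(reg u0).
  exists (degree u0); split; last by rewrite Gn.
    by rewrite -(ltr_nat R); apply: lt_le_trans cd; rewrite mulr_gt0 // ltr0n.
  by move=> u; have := reg u; rewrite -(reg u0) => -[].
split=> G Gn => [|[A bip]] /(degs G Gn)[d [d0 reg cd]].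
  have st : regular_between c 1 d [set: G] [set: G].
    by split=> // *; rewrite ?inE ?cardsT ?mul1r.
  have [||P [P1 P2 P3]] := H1 G d _ _ st; last first.
    exists P; rewrite -Gn; split=> //.
    by apply: cut => //; rewrite divr_ge0 // ltW.
  by rewrite Gn.
  by rewrite -cards_eq0 cardsT Gn -lt0n.
have AB := bipartite_regular_card d0 reg bip.
have AG : (#|A| + #|~: A| = n)%N by rewrite cardsC.
have st : regular_between c (1 / 2) d A (~: A).
  split=> // [u v /bip|u v /bip|u|]; rewrite ?inE.
  - by move=> H uA; move: H; rewrite uA; case: (v \in A).
  - by move=> H /negbTE uA; move: H; rewrite uA; case: (v \in A).
  - by case: (u \in A).
  - by rewrite Gn -AG -AB natrD; lra.
have [||P [P1 P2 P3]] := H2 G d _ _ st; last first.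
- exists P; rewrite -Gn; split=> //.
  by apply: cut => //; rewrite ?mulr_gt0 // divr_ge0 // mulr_ge0 // ltW.
- by rewrite Gn.
rewrite -cards_eq0 -lt0n; move: n_gt0; rewrite -AG -AB addnn double_gt0 //.
Qed.
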